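(* Let $V\in\mathbb{R}^{d\times n}$. Ordering the maximal cells of the covector decomposition $\mathcal{CD}(V)$ lexicographically by their coarse types induces a shelling of the one-point compactification of $\mathcal{CD}(V)$.
   Context: Let $v^{(1)},\dots,v^{(n)}$ be the columns of $V$. For $x\in\mathbb{R}^d/\mathbb{R}\mathbf{1}$ its covector is $G(x)=(G_1(x),\dots,G_d(x))$ with $G_i(x)=\{j\in[n] : x_i-v^{(j)}_i=\min_{k}(x_k-v^{(j)}_k)\}$. For $H=(H_1,\dots,H_d)$, $X_H=\{x : G_i(x)\supseteq H_i\ \forall i\}$ is the covector cell; the covector decomposition $\mathcal{CD}(V)$ is the polyhedral complex in $\mathbb{R}^d/\mathbb{R}\mathbf{1}$ of all nonempty covector cells. The coarse type of $x$ is $(|G_1(x)|,\dots,|G_d(x)|)$; all points in the interior of a maximal cell share the same coarse type (a lattice point of $n\Delta_{d-1}$), called the coarse type of that cell, and distinct maximal cells have distinct coarse types. The one-point compactification of $\mathcal{CD}(V)$ lives in $(\mathbb{R}^d/\mathbb{R}\mathbf{1})\cup\{*\}\cong\mathbb{S}^{d-1}$, with each unbounded cell $C$ replaced by $C\cup\{*\}$. Shelling is in the sense of Björner–Wachs: a total ordering $\sigma_1,\dots,\sigma_m$ of the maximal cells of a $k$-dimensional regular cell complex is a shelling if $k=0$ or (S1) some ordering of the maximal cells of $\partial\sigma_1$ is a shelling; (S2) for $2\le j\le m$, $\partial\sigma_j\cap\bigcup_{i<j}\partial\sigma_i$ is pure of dimension $\dim\sigma_j-1$; (S3) for $2\le j\le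 m$ there is a shelling of the maximal cells of $\partial\sigma_j$ in which the maximal cells of $\partial\sigma_j\cap\bigcup_{i<j}\partial\sigma_i$ come first. *)

(* Defs.v *)
From HB Require Import structures.
From mathcomp Require Import all_boot all_order all_algebra.
From mathcomp Require Import all_classical all_reals.
From mathcomp Require Import topology normedtype.

Set Implicit Arguments.
Unset Strict Implicit.
Unset Printing Implicit Defensive.

Import Order.TTheory GRing.Theory Num.Theory.
Import numFieldNormedType.Exports.

Local Open Scope classical_set_scope.
Local Open Scope ring_scope.
Local Open Scope quotient_scope.

Section Shelling.
Variables (T : Type) (dim : set T -> nat).
Implicit Types (K M : set (set T)) (c : set T) (s : seq (set T)).

(* A complex is given by its set of closed cells, ordered by inclusion. *)
Definition maximal_cells K : set (set T) :=
  [set c | K c /\ forall c', K c' -> c `<=` c' -> c' = c].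

Definition enumerates M s : Prop := uniq s /\ forall c, c \in s <-> M c.

Definition complex_dim K (k : nat) : Prop :=
  (exists2 c, K c & dim c = k) /\ forall c, K c -> (dim c <= k)%N.

Definition pure_of_dim K (k : nat) : Prop :=
  K !=set0 /\ forall c, maximal_cells K c -> dim c = k.

(* In a regular cell complex the boundary of the closed cell c is the union of
   the cells properly contained in c. *)
Definition boundary K c : set (set T) := [set c' | K c' /\ c' `<` c].

Definition meet_earlier K s c : set (set T) :=
  boundary K c `&` [set c' | exists2 b, b \in s & boundary K b c'].

(* s1 is the list of the cells preceding c, so s1 != [::] says that c is not
   the first cell; m.+1 = dim c spells m = dim c - 1 without truncation. *)
Inductive shelling K s : Prop :=
| Shelling0 of enumerates (maximal_cells K) s & complex_dim K 0
| ShellingS k of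
    enumerates (maximal_cells K) s &
    complex_dim K k.+1 &
    (forall c s2, s = c :: s2 -> exists t, shelling (boundary K c) t) &
    (forall s1 c s2, s = s1 ++ c :: s2 -> s1 != [::] ->
       exists2 m, m.+1 = dim c & pure_of_dim (meet_earlier K s1 c) m) &
    (forall s1 c s2, s = s1 ++ c :: s2 -> s1 != [::] ->
       exists t1 t2, shelling (boundary K c) (t1 ++ t2) /\
         enumerates (maximal_cells (meet_earlier K s1 c)) t1).

End Shelling.

Section Torus.
Variables (R : realType) (d : nat).

Definition torus_rel (x y : 'rV[R]_d) : bool :=
  `[< exists a : R, y = x + const_mx a >].

Lemma torus_rel_refl : reflexive torus_rel.
Proof. by move=> x; apply/asboolP; exists 0; rewrite raddf0 addr0. Qed.

Lemma torus_rel_sym : symmetric torus_rel.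
Proof.
have H x y : torus_rel x y -> torus_rel y x.
  move=> /asboolP[a ->]; apply/asboolP; exists (- a).
  by rewrite raddfN addrK.
by move=> x y; apply/idP/idP; apply: H.
Qed.

Lemma torus_rel_trans : transitive torus_rel.
Proof.
move=> y x z /asboolP[a ->] /asboolP[b ->]; apply/asboolP; exists (a + b).
by rewrite raddfD addrA.
Qed.

Canonical torus_equiv :=
  EquivRel torus_rel torus_rel_refl torus_rel_sym torus_rel_trans.

Definition torus : Type := quotient_topology {eq_quot torus_equiv}.
HB.instance Definition _ := Quotient.on torus.
HB.instance Definition _ := Choice.on torus.
HB.instance Definition _ := Topological.on torus.

(* The quotient norm of R^d / R1 is max_i x_i - min_k x_k, up to a factor. *)
Definition torus_bounded (C : set torus) : Prop :=
  exists M : R, forall p, C p -> forall i k, repr p 0 i - repr p 0 k <= M.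

(* Dimension of the affine hull: the largest k such that C contains k + 1 points
   p0, p_0, ..., p_(k-1) whose differences are linearly independent in R^d / R1,
   i.e., linearly independent together with the all-ones vector in R^d. The
   value on the empty set is 0. *)
Definition affine_dim (C : set torus) : nat :=
  \max_(k < d | `[< exists (p0 : torus) (p : 'I_k -> torus),
      [/\ C p0, forall i, C (p i) &
          row_free (col_mx (\matrix_(i < k) (repr (p i) - repr p0))
                           (const_mx 1 : 'rV[R]_d))] >]) k.

End Torus.

Section CovectorDecomposition.
Variables (R : realType) (d n : nat) (V : 'M[R]_(d, n)).
Local Notation torus := (torus R d).
Local Notation compact_torus := (one_point_compactification torus).

Definition point_covector (x : 'rV[R]_d) : {ffun 'I_d -> {set 'I_n}} :=
  [ffun i => [set j | [forall k, x 0 i - V i j <= x 0 k - V k j]]%SET].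

Definition covector (p : torus) : {ffun 'I_d -> {set 'I_n}} :=
  point_covector (repr p).

Lemma covector_pi (x : 'rV[R]_d) : covector (\pi_torus x) = point_covector x.
Proof.
rewrite /covector.
have /eqmodP/asboolP[a ->] :
    x = repr (\pi_torus x) %[mod {eq_quot torus_equiv R d}] by rewrite reprK.
apply/ffunP => i; rewrite !ffunE; apply/setP => j.
rewrite !inE; apply: eq_forallb => k; rewrite !mxE.
by rewrite -!addrA ![a - _]addrC !addrA lerD2r.
Qed.

Definition covector_cell (H : {ffun 'I_d -> {set 'I_n}}) : set torus :=
  [set p | forall i, H i \subset covector p i].

(* H ranges over the covectors of points: for an arbitrary tuple of subsets, say
   the empty ones, covector_cell H is a union of cells of the complex. *)
Definition covector_decomposition : set (set torus) :=
  [set C | exists2 H, range covector H & C = covector_cell H].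

Definition coarse_type (p : torus) : d.-tuplelexi nat :=
  [tuple #|covector p i| | i < d].

(* The coarse type is constant on the interior of a maximal cell, which is not
   empty, so that the point chosen by xget is irrelevant. *)
Definition cell_coarse_type (C : set torus) : d.-tuplelexi nat :=
  coarse_type (xget (\pi_torus 0) C°).

Definition lexicographic_ordering (s : seq (set torus)) : Prop :=
  enumerates (maximal_cells covector_decomposition) s /\
  sorted <=%O [seq cell_coarse_type C | C <- s].

Definition compactify (C : set torus) : set compact_torus :=
  Some @` C `|` [set p | p = None /\ ~ torus_bounded C].

(* The point at infinity is itself a cell as soon as it lies on some cell, that
   is, unless d = 1. *)
Definition compactified_decomposition : set (set compact_torus) :=
  compactify @` covector_decomposition `|`
  [set D | D = [set None] /\
     exists2 C, covector_decomposition C & ~ torus_bounded C].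

(* In particular {oo} has dimension 0. *)
Definition compact_cell_dim (D : set compact_torus) : nat :=
  affine_dim (Some @^-1` D).

Lemma lexicographic_ordering_exists : exists s, lexicographic_ordering s.
Proof.
pose l := [seq C <- undup [seq covector_cell H | H : {ffun 'I_d -> {set 'I_n}}]
          | `[< maximal_cells covector_decomposition C >] ].
pose e C C' := (cell_coarse_type C <= cell_coarse_type C')%O.
exists (sort e l); split; last first.
  by rewrite sorted_map; apply: sort_sorted => C C'; apply: le_total.
split=> [|C]; first by rewrite sort_uniq filter_uniq// undup_uniq.
rewrite mem_sort mem_filter mem_undup; split=> [/andP[/asboolP//]|mC].
apply/andP; split; first exact/asboolP.
by have [[H _ ->] _] := mC; apply/mapP; exists H; rewrite ?mem_enum.
Qed.

End CovectorDecomposition.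

(* Main.v *)
Require Import Defs.
From mathcomp Require Import all_boot all_order all_algebra.
From mathcomp Require Import all_classical all_reals.
From mathcomp Require Import topology normedtype lra ring.

Set Implicit Arguments.
Unset Strict Implicit.
Unset Printing Implicit Defensive.

Import Order.TTheory GRing.Theory Num.Theory.
Import numFieldNormedType.Exports.

Local Open Scope ring_scope.
Local Open Scope quotient_scope.

(**
  The function F(x) = sum_j min_i (x_i - v_ij) is concave and piecewise linear.
  Its domains of linearity are the maximal covector cells, and its slope on a
  cell is the coarse type, so CD(V) is the boundary complex of the hypograph of
  F and the lexicographic order is the order in which a line in direction
  u_1 >> u_2 >> ... >> u_d crosses the facet hyperplanes: a line shelling in the
  sense of Bruggesser and Mani.

  The point at infinity is handled by cutting the hypograph, homogenised to a
  cone, with a hyperplane y = 0 beyond all vertices: every unbounded face then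
  gets exactly one facet in the cut, and the one-point compactification collapses
  the cut to a point. Facets G of a face A are ordered by a_G(p) / a_G(x), where
  a_G is the functional defining G, x a relative interior point of A and p a
  vector in its span; if A is unbounded, both p and x are taken in the cut. Then
  the facets of G shared with earlier facets of A are those visible from
  p - (a_G(p) / a_G(x)) x, and the induction goes on inside G.
*)

(** * Line shellings of truncated cones *)

(** Faces are handled through their active sets alone, so smaller faces have larger sets, and the
    tools are the minimum ratio test and small perturbations. The ratio of a facet [G] of [A] is
    well defined because the functionals active on [G] become proportional on the span of [A]
    ([ridge_ratio]). Visibility passes from facets of [A] to facets of [G] by the diamond property.
    The obstacle is the collapsed point: in dimension above 1 it is not a facet, so when two cells
    share it, purity demands a visible unbounded facet containing it. This is why [p] and [x] stay
    in the cut when [A] is unbounded: rays between them then leave the face at points of the cut,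
    which reveal unbounded faces. Ties between ratios would spoil the order, so each descent from
    [A] to [G] chooses a new generic normalising point in [G]. *)

Lemma small_perturbation (R : realFieldType) (J : finType) (b c : J -> R) :
  exists2 e : R, 0 < e & forall j, 0 < b j -> 0 < b j + e * c j.
Proof.
pose q := \sum_(j | 0 < b j) (`|c j| / b j).
have q0 : 0 <= q.
  by apply: sumr_ge0 => j bj; rewrite divr_ge0 // ltW.
exists (1 + q)^-1; first by rewrite invr_gt0; lra.
move=> j bj.
have cq : `|c j| / b j <= q.
  rewrite /q (bigD1 j) //= lerDl.
  by apply: sumr_ge0 => i /andP[bi _]; rewrite divr_ge0 // ltW.
have : `|c j| <= q * b j by rewrite -ler_pdivrMr.
have cN : - c j <= `|c j| by rewrite -normrN ler_norm.
move=> H; have q1 : 0 < 1 + q by lra.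
rewrite -(pmulr_rgt0 _ q1) mulrDr mulrA mulfV ?gt_eqF // mul1r.
nra.
Qed.

Section Cone.
Variables (R : realFieldType) (W : lmodType R) (I : finType).
Variables (a : I -> W -> R) (y : W -> R).
Hypothesis aP : forall g c u v, a g (c *: u + v) = c * a g u + a g v.
Hypothesis yP : forall c u v, y (c *: u + v) = c * y u + y v.
Implicit Types (A B C G H : {set I}) (p r v w x z : W) (g h : I).

(** * Faces as active sets, and their facets *)

Definition in_cone w := forall g, 0 <= a g w.
Definition active w : {set I} := [set g | a g w == 0]%SET.
Definition face A := exists w, [/\ in_cone w, 0 < y w & active w = A].
Definition unbounded_face A :=
  exists r, [/\ in_cone r, y r < 0 & A \subset active r].
Definition in_span A v := forall g, g \in A -> a g v = 0.
Definition ridge A G :=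
  [/\ face G, A \proper G &
      forall C, face C -> A \proper C -> C \subset G -> C = G].

(* The truncating hyperplane y = 0 lies beyond every vertex: a face reaching it
   is unbounded, and is already seen at y > 0. The functionals all vanish on the
   lineality space of the cone only. *)
Hypothesis truncation : forall w, in_cone w -> y w = 0 -> active w != [set: I]%SET ->
  face (active w) /\ unbounded_face (active w).
Hypothesis lineality : forall w, active w = [set: I]%SET -> y w = 0.

Lemma a0 g : a g 0 = 0.
Proof. by have := aP g (-1) 0 0; rewrite scaler0 addr0; lra. Qed.

Lemma aD g u v : a g (u + v) = a g u + a g v.
Proof. by rewrite -[u]scale1r aP mul1r scale1r. Qed.

Lemma aZ g c u : a g (c *: u) = c * a g u.
Proof. by rewrite -[c *: u]addr0 aP a0 addr0. Qed.

Lemma aN g u : a g (- u) = - a g u.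
Proof. by rewrite -scaleN1r aZ mulN1r. Qed.

Lemma y0 : y 0 = 0.
Proof. by have := yP (-1) 0 0; rewrite scaler0 addr0; lra. Qed.

Lemma yD u v : y (u + v) = y u + y v.
Proof. by rewrite -[u]scale1r yP mul1r scale1r. Qed.

Lemma yZ c u : y (c *: u) = c * y u.
Proof. by rewrite -[c *: u]addr0 yP y0 addr0. Qed.

Lemma yN u : y (- u) = - y u.
Proof. by rewrite -scaleN1r yZ mulN1r. Qed.

Definition linE := (aD, aZ, aN, yD, yZ, yN).

Lemma in_active w g : (g \in active w) = (a g w == 0).
Proof. by rewrite inE. Qed.

Lemma a_gt0 w g : in_cone w -> g \notin active w -> 0 < a g w.
Proof. by move=> wK; rewrite in_active lt_def wK andbT. Qed.

Lemma span_active w A : A \subset active w -> in_span A w.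
Proof. by move=> /fintype.subsetP Aw g /Aw; rewrite in_active => /eqP. Qed.

Lemma unbounded_face_sub A B : A \subset B -> unbounded_face B -> unbounded_face A.
Proof. by move=> AB [r [rK yr Br]]; exists r; split=> //; apply: fintype.subset_trans AB Br. Qed.

Lemma face_neqT A : face A -> A != [set: I]%SET.
Proof.
move=> [w [_ yw <-]]; apply/eqP => /lineality yw0.
by rewrite yw0 ltxx in yw.
Qed.

(** Minimum ratio test: a direction in the span keeps the active functionals at zero, so the ray
    leaves the cone where the first decreasing functional vanishes. *)
Lemma exit_point w p h : in_cone w -> in_span (active w) p -> a h p < 0 ->
  exists t g, [/\ 0 < t, in_cone (w + t *: p), a g p < 0,
    g \in active (w + t *: p) & active w \proper active (w + t *: p)].
Proof.
move=> wK wp hp.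
have pos g : a g p < 0 -> 0 < a g w.
  move=> gp; apply: a_gt0 => //; apply/negP => /wp gp0.
  by rewrite gp0 ltxx in gp.
have [g gp gmin] := arg_minP (fun g => a g w / - a g p) (P := fun g => a g p < 0) hp.
have gpos := pos _ gp.
set t := a g w / - a g p in gmin.
have t0 : 0 < t by rewrite divr_gt0 // oppr_gt0.
have gz : a g (w + t *: p) = 0.
  have gp' : - a g p != 0 by rewrite gt_eqF // oppr_gt0.
  by have := divfK gp' (a g w); rewrite -/t !linE; lra.
have inz : g \in active (w + t *: p) by rewrite in_active gz.
exists t, g; split=> //.
  move=> k; rewrite !linE.
  have [kp|kp] := ltP (a k p) 0; last by rewrite addr_ge0 // mulr_ge0 // ltW.
  by have := gmin _ kp; rewrite ler_pdivlMr ?oppr_gt0 //; lra.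
apply/properP; split.
  apply/fintype.subsetP => k kw; rewrite in_active !linE wp // mulr0 addr0.
  by rewrite -in_active.
by exists g => //; rewrite in_active gt_eqF.
Qed.

Lemma small_step w v : in_cone w -> (forall g, g \in active w -> 0 <= a g v) ->
  0 < y w -> face [set g in active w | a g v == 0]%SET.
Proof.
move=> wK wv yw.
have [e e0 eP] := small_perturbation
  (fun j : option I => if j is Some g then a g w else y w)
  (fun j : option I => if j is Some g then a g v else y v).
exists (w + e *: v); split.
- move=> g; rewrite !linE; have [gw|gw] := boolP (g \in active w).
    by rewrite addr_ge0 // mulr_ge0 ?wv // ltW.
  by rewrite ltW // (eP (Some g)) // a_gt0.
- by rewrite !linE; apply: (eP None).
- apply/setP => g; rewrite in_active 2!inE !linE.
  have [->|gw] := eqVneq (a g w) 0.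
    by rewrite add0r mulf_eq0 (gt_eqF e0).
  by rewrite gt_eqF // (eP (Some g)) // a_gt0 // in_active.
Qed.

Lemma ridge_exists A B : face B -> A \proper B -> exists2 G, ridge A G & G \subset B.
Proof.
have [k] := ubnP #|B|; elim: k B => // k IH B Bk fB AB.
have [[C [fC AC CB]]|noC] :=
  pselect (exists C, [/\ face C, A \proper C & C \proper B]).
  have [] := IH C _ fC AC; first exact: leq_trans (proper_card CB) Bk.
  by move=> G AG GC; exists G => //; apply: fintype.subset_trans GC (proper_sub CB).
exists B => //; split=> // C fC AC CB.
apply/eqP/negPn/negP => CnB; apply: noC; exists C; split=> //.
by rewrite finset.properEneq CnB.
Qed.

(** Subtracting from [v] the multiple of [x] with the smallest ratio leaves a direction that is
    nonnegative on [G] and zero on [A] and on one functional outside [A]. A small step along it from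
    [w] gives a face strictly above [A] and inside [G]; by minimality it is [G], so the direction
    vanishes on all of [G]. *)
Lemma ridge_ratio A G x v : ridge A G -> in_cone x -> active x = A -> in_span A v ->
  exists l, forall h, h \in G -> a h v = l * a h x.
Proof.
move=> [[w [wK yw wG]] AG minG] xK xA Av.
have [AsG [h0 h0G h0A]] := properP AG.
pose f h := a h v / a h x.
have [g /andP[gG gA] gmin] := arg_minP f (P := fun h => (h \in G) && (h \notin A))
  (introT andP (conj h0G h0A)).
have xpos h : h \notin A -> 0 < a h x by rewrite -xA; apply: a_gt0.
have xzero h : h \in A -> a h x = 0 by rewrite -xA in_active => /eqP.
pose v' := v - f g *: x.
have v'0 h : h \in G -> 0 <= a h v'.
  move=> hG; rewrite !linE; have [hA|hA] := boolP (h \in A).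
    by rewrite Av // xzero // mulr0 oppr0 addr0.
  have := gmin h; rewrite hG hA => /(_ isT).
  by rewrite /f ler_pdivlMr ?xpos // subr_ge0.
have fC := @small_step w v' wK _ yw.
rewrite wG in fC; have {}fC := fC v'0.
exists (f g) => h hG.
suff : h \in [set g in G | a g v' == 0]%SET.
  by rewrite inE !linE subr_eq0 => /andP[_ /eqP].
rewrite (minG _ fC) //; last by apply/fintype.subsetP => k; rewrite inE => /andP[].
apply/properP; split.
  apply/fintype.subsetP => k kA; rewrite inE (fintype.subsetP AsG) //=.
  by rewrite !linE Av // xzero // mulr0 subrr.
exists g => //; rewrite inE gG /= !linE /f divfK ?subrr //.
by rewrite gt_eqF // xpos.
Qed.

(* All the functionals that vanish first along w_A + s p, among those vanishing on
   B, are negative at p. *)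
Lemma visible_ridge A B p h : face A -> face B -> A \proper B -> in_span A p ->
  h \in B -> a h p < 0 ->
  exists G, [/\ ridge A G, G \subset B & forall g, g \in G -> g \notin A -> a g p < 0].
Proof.
move=> [w [wK yw wA]] [wB [wBK ywB wBB]] AB Ap hB hp.
have wpos g : g \notin A -> 0 < a g w by rewrite -wA; apply: a_gt0.
have wzero g : g \in A -> a g w = 0 by rewrite -wA in_active => /eqP.
have notA g : a g p < 0 -> g \notin A.
  by apply: contraL => /Ap ->; rewrite ltxx.
have [g /andP[gB gp] gmin] := arg_minP (fun g => a g w / - a g p)
  (P := fun g => (g \in B) && (a g p < 0)) (introT andP (conj hB hp)).
set t := a g w / - a g p in gmin.
have t0 : 0 < t by rewrite divr_gt0 ?oppr_gt0 // wpos // notA.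
have fC := @small_step wB (w + t *: p) wBK _ ywB; rewrite wBB in fC.
have {}fC : face [set g in B | a g (w + t *: p) == 0]%SET.
  apply: fC => k kB; rewrite !linE.
  have [kp|kp] := ltP (a k p) 0; last by rewrite addr_ge0 // mulr_ge0 // ltW.
  by have := gmin k; rewrite kB kp => /(_ isT); rewrite ler_pdivlMr ?oppr_gt0 //; lra.
have [|G AG GC] := ridge_exists (A := A) fC.
  apply/properP; split.
    apply/fintype.subsetP => k kA; rewrite inE (fintype.subsetP (proper_sub AB)) //=.
    by rewrite !linE Ap // wzero // mulr0 addr0.
  exists g; last exact: notA.
  have gp' : - a g p != 0 by rewrite gt_eqF // oppr_gt0.
  rewrite inE gB /= !linE; apply/eqP.
  by have := divfK gp' (a g w); rewrite -/t; lra.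
exists G; split=> //.
  by apply: fintype.subset_trans GC _; apply/fintype.subsetP => k; rewrite inE => /andP[].
move=> k /(fintype.subsetP GC); rewrite inE => /andP[_]; rewrite !linE => /eqP kz /wpos kw.
by rewrite -(pmulr_rlt0 _ t0); lra.
Qed.

(** At [- w], with [w] in the relative interior of [G], the functionals of [G] vanish and the others
    are negative, so a facet visible from there has a functional outside [G]. *)
Lemma diamond A G H : face A -> ridge A G -> ridge G H ->
  exists G', [/\ ridge A G', G' \subset H & exists2 g, g \in G' & g \notin G].
Proof.
move=> fA [[w [wK yw wG]] AG _] [fH GH _].
have [_ [h hH hG]] := properP GH.
have hw : a h (- w) < 0 by rewrite linE oppr_lt0 a_gt0 // wG.
have [|G' [AG' G'H G'neg]] := visible_ridge fA fH (proper_trans AG GH) _ hH hw.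
  by move=> g gA; rewrite linE (span_active (w := w) (A := A)) ?oppr0 // wG proper_sub.
exists G'; split=> //; have [_ /properP[_ [g gG' gA]] _] := AG'.
exists g => //; have := G'neg g gG' gA; apply: contraL; rewrite -wG in_active linE => /eqP ->.
by rewrite oppr0 ltxx.
Qed.

(** * Faces meeting the cut [y = 0] *)

Lemma face_at_infinity A : face A -> unbounded_face A ->
  exists x, [/\ in_cone x, y x = 0 & active x = A].
Proof.
move=> [w [wK yw wA]] [r [rK yr Ar]].
exists (w + (y w / - y r) *: r).
have t0 : 0 < y w / - y r by rewrite divr_gt0 // oppr_gt0.
split.
- by move=> g; rewrite !linE addr_ge0 // mulr_ge0 // ltW.
- have yr' : - y r != 0 by rewrite gt_eqF // oppr_gt0.
  by have := divfK yr' (y w); rewrite !linE; lra.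
- apply/setP => g; rewrite in_active -wA in_active !linE.
  have [g0|gn0] := eqVneq (a g w) 0.
    by rewrite g0 add0r (span_active Ar) ?mulr0 ?eqxx // -wA in_active g0.
  have gw : 0 < a g w by rewrite a_gt0 // in_active.
  by apply: gt_eqF; apply: ltr_pwDl => //; rewrite mulr_ge0 // ltW.
Qed.

Lemma unbounded_subface A : face A -> unbounded_face A -> exists2 B, face B & A \proper B.
Proof.
move=> fA uA; have [x [xK yx xA]] := face_at_infinity fA uA.
have := face_neqT fA; rewrite -finset.subTset => /subsetPn[h _ hA].
have hx : a h (- x) < 0 by rewrite linE oppr_lt0 a_gt0 // xA.
have [w [wK yw wA]] := fA.
have [|t [g [t0 zK gx gz Az]]] := exit_point (p := - x) wK _ hx.
  by move=> g; rewrite wA -xA in_active linE => /eqP ->; rewrite oppr0.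
exists (active (w + t *: (- x))); last by rewrite -{1}wA.
by exists (w + t *: (- x)); split=> //; rewrite !linE yx oppr0 mulr0 addr0.
Qed.

(** A direction with [y v = 0] keeps [y] positive, so an exit point along [v] or [- v] would be a
    proper face of the vertex. *)
Lemma vertex_span A v : face A -> (forall B, face B -> ~~ (A \proper B)) ->
  in_span A v -> y v = 0 -> forall g, a g v = 0.
Proof.
move=> [w [wK yw wA]] Amin Av yv.
have pos p : in_span A p -> y p = 0 -> forall g, 0 <= a g p.
  move=> Ap yp g; rewrite leNgt; apply/negP => gp.
  have [|t [h [t0 zK hp hz]]] := exit_point (p := p) wK _ gp; first by rewrite wA.
  rewrite wA; apply/negP/Amin; exists (w + t *: p); split=> //.
  by rewrite !linE yp mulr0 addr0.
move=> g; have := pos v Av yv g; have := pos (- v) _ _ g; rewrite !linE yv oppr0.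
move=> H1 H2; apply/le_anti; rewrite H2 andbT -oppr_ge0 H1 //.
by move=> h hA; rewrite linE Av // oppr0.
Qed.

(** The exit point along [p] gives [B], unless it lands in the lineality space; then every
    functional outside [G] is negative at [p] and any proper face serves. A bounded [G] cannot be
    left at [y <= 0]. *)
Lemma negative_subface G p h : face G -> (exists2 B, face B & G \proper B) ->
  in_span G p -> (unbounded_face G -> y p = 0) -> a h p < 0 ->
  exists B, [/\ face B, G \proper B & exists2 g, g \in B & a g p < 0].
Proof.
move=> fG [B fB GB] Gp Gy hp.
have [w [wK wG yw0 yw]] : exists w, [/\ in_cone w, active w = G,
    unbounded_face G -> y w = 0 & ~ unbounded_face G -> 0 < y w].
  have [uG|bG] := pselect (unbounded_face G).
    by have [x [xK yx xG]] := face_at_infinity fG uG; exists x; split.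
  by have [w [wK yw wG]] := fG; exists w; split.
have [|t [g [t0 zK gp gz Gz]]] := exit_point (p := p) wK _ hp; first by rewrite wG.
have [zT|zT] := eqVneq (active (w + t *: p)) [set: I]%SET.
  exists B; split=> //; have [_ [k kB kG]] := properP GB; exists k => //.
  have : k \in active (w + t *: p) by rewrite zT inE.
  rewrite in_active !linE => /eqP kz; rewrite -(pmulr_rlt0 _ t0).
  have : 0 < a k w by rewrite a_gt0 // wG.
  lra.
exists (active (w + t *: p)); split; [|by rewrite -{1}wG|by exists g].
have [uG|bG] := pselect (unbounded_face G).
  by case: (truncation zK _ zT) => //; rewrite !linE Gy // yw0 // mulr0 addr0.
have sGz : G \subset active (w + t *: p) by rewrite -{1}wG proper_sub.
have [yz|yz|yz] := ltgtP (y (w + t *: p)) 0.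
- by case: bG; exists (w + t *: p).
- by exists (w + t *: p).
- by have [_ /(unbounded_face_sub sGz)] := truncation zK yz zT.
Qed.

(** The direction [p] lies in the cut and vanishes on [B], so a functional of [B] outside [G] stays
    positive along the ray and keeps the exit point out of the lineality space; [C] supplies a
    functional that decreases. *)
Lemma unbounded_proper_subface G B C : face G -> face B -> face C ->
  G \proper B -> B \proper C -> unbounded_face G ->
  exists B', [/\ face B', unbounded_face B' & G \proper B'].
Proof.
move=> fG [wB [wBK ywB wBB]] [wC [wCK ywC wCC]] GB BC uG.
have [x [xK yx xG]] := face_at_infinity fG uG.
pose p := y wB *: wC - y wC *: wB.
have [_ [h hC hB]] := properP BC; have [_ [k kB kG]] := properP GB.
have Bp g : g \in B -> a g p = 0.
  move=> gB; have := fintype.subsetP (proper_sub BC) _ gB; move: gB.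
  by rewrite -wBB -wCC !in_active !linE => /eqP -> /eqP ->; rewrite !mulr0 subrr.
have hp : a h p < 0.
  move: hC; rewrite -wCC in_active !linE => /eqP ->; rewrite mulr0 add0r oppr_lt0.
  by rewrite mulr_gt0 // a_gt0 // wBB.
have [|t [g [t0 zK gp gz Gz]]] := exit_point (p := p) xK _ hp.
  by move=> g; rewrite xG => /(fintype.subsetP (proper_sub GB)) /Bp.
have zT : active (x + t *: p) != [set: I]%SET.
  apply/eqP => zT; have : k \in active (x + t *: p) by rewrite zT inE.
  rewrite in_active aD aZ Bp // mulr0 addr0 gt_eqF // a_gt0 //.
  by rewrite xG.
have [] := truncation zK _ zT; first by rewrite !linE yx; lra.
by exists (active (x + t *: p)); split=> //; rewrite -{1}xG.
Qed.

Lemma negative_unbounded_subface G B C p h : face G -> face B -> face C ->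
  G \proper B -> B \proper C -> unbounded_face G ->
  in_span G p -> y p = 0 -> a h p < 0 ->
  exists B', [/\ face B', unbounded_face B', G \proper B' & exists2 g, g \in B' & a g p < 0].
Proof.
move=> fG fB fC GB BC uG Gp yp hp.
have [x [xK yx xG]] := face_at_infinity fG uG.
have [|t [g [t0 zK gp gz Gz]]] := exit_point (p := p) xK _ hp; first by rewrite xG.
have [zT|zT] := eqVneq (active (x + t *: p)) [set: I]%SET.
  have [B' [fB' uB' GB']] := unbounded_proper_subface fG fB fC GB BC uG.
  exists B'; split=> //; have [_ [k kB kG]] := properP GB'; exists k => //.
  have : k \in active (x + t *: p) by rewrite zT inE.
  rewrite in_active !linE => /eqP kz; rewrite -(pmulr_rlt0 _ t0).
  have : 0 < a k x by rewrite a_gt0 // xG.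
  lra.
have [] := truncation zK _ zT; first by rewrite !linE yx yp; lra.
by exists (active (x + t *: p)); split=> //; [rewrite -{1}xG | exists g].
Qed.

(** For a ridge the value does not depend on the [g] picked, by [ridge_ratio], and the default 0 is
    never reached. *)
Definition ratio A p x G : R :=
  if [pick g in G :\: A] is Some g then a g p / a g x else 0.

Lemma ratioP A p x G : ridge A G -> in_cone x -> active x = A -> in_span A p ->
  forall h, h \in G -> a h p = ratio A p x G * a h x.
Proof.
move=> AG xK xA Ap; have [l lP] := ridge_ratio AG xK xA Ap.
suff -> : ratio A p x G = l by [].
rewrite /ratio; case: pickP => [g|].
  rewrite inE => /andP[gA gG]; rewrite lP // mulfK //.
  by rewrite gt_eqF // a_gt0 // xA.
have [_ /properP[_ [g gG gA]] _] := AG.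
by move=> /(_ g); rewrite inE gG gA.
Qed.

Lemma ridge_not_sub A G H : ridge A G -> ridge A H -> G != H ->
  exists2 g, g \in G & g \notin H.
Proof.
move=> [fG AG _] [_ _ Hmin] GH.
have [/(Hmin _ fG AG) /eqP|/subsetPn //] := boolP (G \subset H).
by rewrite (negPf GH).
Qed.

(** Pairs are treated one at a time: if [d q] vanishes at the current point but not at some
    admissible [v], a step along [v] repairs it, small enough to preserve the inequalities already
    gained. *)
Lemma generic_point G p x0 : in_cone x0 -> active x0 = G -> (unbounded_face G -> y x0 = 0) ->
  exists x, [/\ in_cone x, active x = G, unbounded_face G -> y x = 0 &
    forall h h' v, in_span G v -> y v = 0 -> a h p * a h' v != a h' p * a h v ->
      a h p * a h' x != a h' p * a h x].
Proof.
move=> x0K x0G yx0.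
pose d (q : I * I) w := a q.1 p * a q.2 w - a q.2 p * a q.1 w.
suff H (s : seq (I * I)) : exists x, [/\ in_cone x, active x = G,
    unbounded_face G -> y x = 0 & forall q v, q \in s -> in_span G v -> y v = 0 ->
      d q v != 0 -> d q x != 0].
  have [x [xK xG yx xP]] := H (enum {: I * I}); exists x; split=> // h h' v Gv yv.
  by have := xP (h, h') v (mem_enum _ _) Gv yv; rewrite /d !subr_eq0.
elim: s => [|q s [x [xK xG yx IH]]]; first by exists x0; split.
have [[v [Gv yv qv qx]]|no] :=
  pselect (exists v, [/\ in_span G v, y v = 0, d q v != 0 & d q x = 0]); last first.
  exists x; split=> // q' v; rewrite inE => /orP[/eqP -> Gv yv qv|]; last exact: IH.
  by apply/eqP => qx; apply: no; exists v.
have dP q' e : d q' (x + e *: v) = d q' x + e * d q' v by rewrite /d !linE; ring.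
(* Positivity of [d q' x * d q' (x + e *: v)] says that [d q'] stays nonzero, whatever its sign. *)
have [e e0 eP] := small_perturbation
  (fun j : I + (I * I) => match j with inl g => a g x | inr q' => d q' x ^+ 2 end)
  (fun j : I + (I * I) => match j with inl g => a g v | inr q' => d q' x * d q' v end).
exists (x + e *: v); split.
- move=> g; rewrite !linE; have [gx|gx] := boolP (g \in active x).
    by rewrite Gv ?mulr0 ?addr0 // -xG.
  by rewrite ltW // (eP (inl g)) // a_gt0.
- apply/setP => g; rewrite in_active !linE; have [gx|gx] := boolP (g \in G).
    by rewrite Gv // (span_active (w := x) (A := G)) ?xG // mulr0 addr0 eqxx.
  by apply: gt_eqF; apply: (eP (inl g)); apply: a_gt0 => //; rewrite xG.
- by move=> /yx yx'; rewrite !linE yx' yv mulr0 addr0.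
- move=> q' v'; have [-> _ _ _ _|] := eqVneq q' q.
    by rewrite dP qx add0r mulf_neq0 // gt_eqF.
  move=> qq'; rewrite inE (negPf qq') /= => q's Gv' yv' q'v'.
  have q'x := IH q' v' q's Gv' yv' q'v'.
  have := eP (inr q'); rewrite /= lt_def sqrf_eq0 q'x sqr_ge0 => /(_ isT).
  rewrite dP => Hpos; apply/eqP => H0.
  have : d q' x * (d q' x + e * d q' v) = 0 by rewrite H0 mulr0.
  by move: Hpos; rewrite expr2; lra.
Qed.

Lemma generic_ratio G p : face G -> in_span G p ->
  (forall H h, ridge G H -> h \in H -> h \notin G -> a h p != 0) ->
  exists x, [/\ in_cone x, active x = G, unbounded_face G -> y x = 0 &
    forall H H', ridge G H -> ridge G H' -> H != H' -> ratio G p x H != ratio G p x H'].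
Proof.
move=> fG Gp pn0.
have [x0 [x0K x0G yx0]] : exists x, [/\ in_cone x, active x = G & unbounded_face G -> y x = 0].
  have [uG|bG] := pselect (unbounded_face G).
    by have [x [xK yx xG]] := face_at_infinity fG uG; exists x; split.
  by have [w [wK yw wG]] := fG; exists w; split.
have [x [xK xG yx xP]] := generic_point p x0K x0G yx0.
exists x; split=> // H H' GH GH' HH'; apply/eqP => lE.
have [h hH hH'] := ridge_not_sub GH GH' HH'.
have [|h' h'H' h'H] := ridge_not_sub GH' GH; first by rewrite eq_sym.
have [[w [wK yw wH]] GsH _] := GH; have [[w' [w'K yw' wH']] GsH' _] := GH'.
have hG : h \notin G by apply: contra hH'; apply/fintype.subsetP/proper_sub.
have h'G : h' \notin G by apply: contra h'H; apply/fintype.subsetP/proper_sub.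
have hl := ratioP GH xK xG Gp hH; have h'l := ratioP GH' xK xG Gp h'H'.
rewrite -lE in h'l; set l := ratio G p x H in hl h'l.
have hp := pn0 H h GH hH hG; rewrite hl mulf_eq0 negb_or in hp.
have /andP[l0 _] := hp.
have x1 : 0 < a h x by rewrite a_gt0 // xG.
have x2 : 0 < a h' x by rewrite a_gt0 // xG.
have hw : a h w = 0 by apply/eqP; rewrite -in_active wH.
have h'w' : a h' w' = 0 by apply/eqP; rewrite -in_active wH'.
have x3 : 0 < a h w' by rewrite a_gt0 // wH'.
have x4 : 0 < a h' w by rewrite a_gt0 // wH.
suff : a h p * a h' x != a h' p * a h x.
  by rewrite hl h'l => /eqP; apply; ring.
(* A direction of the cut pointing from [H'] to [H]: [a h] is negative on it and [a h'] positive, so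
   it tells the two products apart. *)
apply: (xP h h' (y w' *: w - y w *: w')).
- have wspan : in_span G w by apply: span_active; rewrite wH proper_sub.
  have w'span : in_span G w' by apply: span_active; rewrite wH' proper_sub.
  by move=> g gG; rewrite !linE wspan // w'span //; ring.
- by rewrite !linE; ring.
- rewrite hl h'l !linE hw h'w' -subr_eq0.
  rewrite (_ : _ - _ = l * (a h x * (y w' * a h' w) + a h' x * (y w * a h w'))); last by ring.
  by rewrite mulf_neq0 // gt_eqF // addr_gt0 // !mulr_gt0.
Qed.

(** * Dimensions and cells of faces *)

Variable dm : {set I} -> nat.
Hypothesis dm_ridge : forall A G, face A -> ridge A G -> dm A = (dm G).+1.
Hypothesis dm_vertex : forall A, face A -> (forall B, face B -> ~~ (A \proper B)) ->
  dm A = 0%N.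

Lemma dm_proper A B : face A -> face B -> A \proper B -> (dm B < dm A)%N.
Proof.
have [k] := ubnP (dm A); elim: k A => // k IH A Ak fA fB AB.
have [G AG GB] := ridge_exists fB AB; have [fG _ _] := AG.
have AE := dm_ridge fA AG.
have [<-|GnB] := eqVneq G B; first by rewrite AE.
rewrite (@ltn_trans (dm G)) ?AE //.
by apply: IH => //; [rewrite -AE | rewrite finset.properEneq GnB].
Qed.

Lemma dm_gt0 A : face A -> (0 < dm A)%N -> exists2 B, face B & A \proper B.
Proof.
move=> fA A0; apply: contrapT => no; move: A0; rewrite dm_vertex // => B fB.
by apply/negP => AB; apply: no; exists B.
Qed.

Lemma dm_gt1 A : face A -> (1 < dm A)%N ->
  exists B C, [/\ face B, face C, A \proper B & B \proper C].
Proof.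
move=> fA A1; have [B fB AB] := dm_gt0 fA (ltnW A1).
have [G AG GB] := ridge_exists fB AB; have [fG AsG _] := AG.
have [|C fC GC] := dm_gt0 fG; first by rewrite (dm_ridge fA AG) in A1.
by exists G, C.
Qed.

Lemma unbounded_dm_gt0 A : face A -> unbounded_face A -> (0 < dm A)%N.
Proof.
move=> fA uA; have [B fB AB] := unbounded_subface fA uA.
exact: leq_ltn_trans (dm_proper fA fB AB).
Qed.

Variables (T : Type) (dim : set T -> nat) (cell : {set I} -> set T) (pt : set T).
(** The empty active set is the whole cone, whose boundary is the complex; it is not itself a cell,
    hence the conditions [A != set0]. *)
Hypothesis cell_sub : forall A B, face A -> face B -> A != finset.set0 ->
  B != finset.set0 -> (cell A `<=` cell B)%classic <-> B \subset A.
Hypothesis pt_sub : forall A, face A -> A != finset.set0 ->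
  (pt `<=` cell A)%classic <-> unbounded_face A.
Hypothesis cell_pt : forall A, face A -> A != finset.set0 -> ~ (cell A `<=` pt)%classic.
Hypothesis dim_cell : forall A, face A -> A != finset.set0 -> dim (cell A) = dm A.
Hypothesis dim_pt : dim pt = 0%N.

(* The boundary of the face A, where [pt] stands for the collapsed cut. *)
Definition cplx A : set (set T) := fun c =>
  (exists B, [/\ face B, A \proper B & c = cell B]) \/ (unbounded_face A /\ c = pt).

Lemma proper_neq0 A B : A \proper B -> B != finset.set0.
Proof.
by move=> AB; rewrite -finset.proper0; apply: sub_proper_trans AB; apply: finset.sub0set.
Qed.

Lemma cell_inj A B : face A -> face B -> A != finset.set0 -> B != finset.set0 ->
  cell A = cell B -> A = B.
Proof.
move=> fA fB A0 B0 AB; apply/eqP; rewrite finset.eqEsubset.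
by apply/andP; split; apply/cell_sub => //; rewrite AB.
Qed.

Lemma ridge_cell_inj A G H : ridge A G -> ridge A H -> cell G = cell H -> G = H.
Proof. by move=> [fG AG _] [fH AH _]; apply: cell_inj => //; apply: proper_neq0; eassumption. Qed.

Lemma cell_pt_neq A : face A -> A != finset.set0 -> cell A <> pt.
Proof. by move=> fA A0 E; apply: (cell_pt fA A0); rewrite E. Qed.

Lemma cplx_cell A B : face B -> A \proper B -> cplx A (cell B).
Proof. by left; exists B. Qed.

(** Boundaries of cells have again the form [cplx], collapsed point included, so the induction can
    descend. *)
Lemma boundary_cplx A B : face B -> A \proper B -> boundary (cplx A) (cell B) = cplx B.
Proof.
move=> fB AB; have B0 := proper_neq0 AB; apply/seteqP; split=> c.
  move=> [[[C [fC AC ->]]|[uA ->]] [sub nsub]].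
    have C0 := proper_neq0 AC; left; exists C; split=> //.
    rewrite fintype.properE; apply/andP; split; first exact/cell_sub.
    by apply/negP => CB; apply: nsub; apply/cell_sub.
  by right; split=> //; apply/pt_sub.
move=> [[C [fC BC ->]]|[uB ->]].
  have C0 := proper_neq0 BC; split; first by apply: cplx_cell => //; apply: proper_trans BC.
  split; first by apply/cell_sub => //; apply: proper_sub.
  by move=> /cell_sub -/(_ fB fC B0 C0); move: BC; rewrite fintype.properE => /andP[_ /negP].
split; first by right; split=> //; apply: unbounded_face_sub uB; apply: proper_sub.
split; first exact/pt_sub.
exact: cell_pt.
Qed.

Lemma dim_cplx A c : face A -> cplx A c -> (dim c < dm A)%N.
Proof.
move=> fA [[B [fB AB ->]]|[uA ->]]; last by rewrite dim_pt unbounded_dm_gt0.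
by rewrite dim_cell ?dm_proper //; apply: proper_neq0 AB.
Qed.

Lemma maximal_cplx A c : face A -> (1 < dm A)%N ->
  maximal_cells (cplx A) c <-> exists2 G, ridge A G & c = cell G.
Proof.
move=> fA A1; split.
  move=> [[[B [fB AB ->]]|[uA ->]] cmax].
    have [G AG GB] := ridge_exists fB AB; have [fG AsG _] := AG.
    exists G => //; apply/esym/cmax; first exact: cplx_cell.
    by apply/cell_sub => //; apply: proper_neq0; eassumption.
  have [B [C [fB fC AB BC]]] := dm_gt1 fA A1.
  have [B' [fB' uB' AB']] := unbounded_proper_subface fA fB fC AB BC uA.
  have B'0 := proper_neq0 AB'.
  case: (cell_pt_neq fB' B'0); apply: cmax; first exact: cplx_cell.
  exact/pt_sub.
move=> [G [fG AG Gmin] ->]; have G0 := proper_neq0 AG.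
split=> [|c']; first exact: cplx_cell.
move=> [[B [fB AB ->]]|[uA ->]]; last by move=> /(cell_pt fG G0).
have B0 := proper_neq0 AB.
by move=> /cell_sub -/(_ fG fB G0 B0) BG; rewrite (Gmin B).
Qed.

(** For [A] of dimension 1 all cells, [pt] included, are points, so they form an antichain. *)
Lemma maximal_cplx1 A (M : set (set T)) : face A -> dm A = 1%N ->
  (forall c, M c -> cplx A c) -> maximal_cells M = M.
Proof.
move=> fA A1 MA; apply/seteqP; split=> [c []//|c Mc]; split=> // c' Mc' cc'.
have dm0 B : face B -> A \proper B -> dm B = 0%N.
  by move=> fB AB; have := dm_proper fA fB AB; rewrite A1 ltnS leqn0 => /eqP.
move: (MA _ Mc) (MA _ Mc') cc' => [[B [fB AB ->]]|[uA ->]] [[C [fC AC ->]]|[_ ->]] //.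
- have B0 := proper_neq0 AB; have C0 := proper_neq0 AC.
  move=> /cell_sub -/(_ fB fC B0 C0) CB.
  have [->//|CnB] := eqVneq C B.
  by have := @dm_proper C B fC fB; rewrite finset.properEneq CnB CB !dm0 // => /(_ isT).
- by move=> /(cell_pt fB (proper_neq0 AB)).
- have C0 := proper_neq0 AC; move=> /(pt_sub fC C0) /(unbounded_dm_gt0 fC).
  by rewrite dm0.
Qed.

Lemma cplx_enum A : exists2 s : seq (set T), uniq s & forall c, c \in s <-> cplx A c.
Proof.
pose s := [seq c <- pt :: [seq cell B | B : {set I}] | `[< cplx A c >]].
exists (undup s) => [|c]; first exact: undup_uniq.
rewrite mem_undup mem_filter; split=> [/andP[/asboolP]//|Ac].
apply/andP; split; first exact/asboolP.
case: Ac => [[B [_ _ ->]]|[_ ->]]; last exact: mem_head.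
by rewrite inE; apply/orP; right; apply/mapP; exists B; rewrite ?mem_enum.
Qed.

(** * Intersection of a cell with the earlier ones *)

Section Step.
Variables (A G : {set I}) (q : W) (s1 : seq (set T)).
Hypotheses (fA : face A) (AG : ridge A G) (G1 : (0 < dm G)%N).
Hypotheses (Gq : in_span G q) (yq : unbounded_face G -> y q = 0).
Hypothesis s1_ridge : forall c, c \in s1 -> exists2 G', ridge A G' & c = cell G'.
Hypothesis s1_neg : forall G' g, ridge A G' -> cell G' \in s1 ->
  g \in G' -> g \notin A -> a g q < 0.
Hypothesis neg_s1 : forall G' g, ridge A G' -> g \in G' -> g \notin A -> a g q < 0 ->
  cell G' \in s1.

Let M := meet_earlier (cplx A) s1 (cell G).

Let fG : face G. Proof. by case: AG. Qed.
Let AsG : A \proper G. Proof. by case: AG. Qed.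

Lemma meet_earlierP c :
  M c <-> cplx G c /\ exists G', [/\ ridge A G', cell G' \in s1 & cplx G' c].
Proof.
rewrite /M /meet_earlier boundary_cplx //; split=> [[Gc [b bs]]|[Gc [G' [AG' G's G'c]]]].
  have [G' AG' bE] := s1_ridge bs; have [fG' AsG' _] := AG'.
  rewrite bE boundary_cplx // => G'c; split=> //; exists G'; split=> //.
  by rewrite -bE.
have [fG' AsG' _] := AG'.
by split=> //; exists (cell G') => //; rewrite boundary_cplx.
Qed.

(** On the functionals of [H], [q] is a multiple of [w], so those outside [G] all have the sign of
    that multiple. The second ridge of [A] through [H] is therefore visible too, that is,
    earlier. *)
Lemma meet_visible H h : ridge G H -> h \in H -> h \notin G -> a h q < 0 -> M (cell H).
Proof.
move=> GH hH hG hq; have [fH GsH _] := GH; have [w [wK yw wG]] := fG.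
have [G' [AG' G'H [g gG' gG]]] := diamond fA AG GH.
have [fG' AsG' G'min] := AG'.
have gA : g \notin A by apply: contra gG; apply/fintype.subsetP/proper_sub.
have [l lP] := ridge_ratio GH wK wG Gq.
have wpos k : k \notin G -> 0 < a k w by rewrite -wG; apply: a_gt0.
have gq : a g q < 0.
  have gH := fintype.subsetP G'H _ gG'.
  by move: hq; rewrite !lP // !pmulr_llt0 ?wpos.
apply/meet_earlierP; split; first exact: cplx_cell.
exists G'; split=> //; first exact: neg_s1 gq.
apply: cplx_cell => //; rewrite finset.properEneq G'H andbT.
apply: contra gG => /eqP G'E; rewrite (G'min G) // G'E; exact: proper_sub.
Qed.

(** A cell shared with an earlier ridge inherits a functional negative at [q], and [visible_ridge]
    applies. For the point at infinity, an unbounded face with such a functional must be found in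
    the cut. *)
Lemma meet_in_visible c : M c -> (1 < dm G)%N ->
  exists H, [/\ ridge G H, (c `<=` cell H)%classic &
    forall h, h \in H -> h \notin G -> a h q < 0].
Proof.
move=> /meet_earlierP[Gc [G' [AG' G's G'c]]] G2.
have [_ /properP[AsG' [g gG' gA]] _] := AG'; have gq := s1_neg AG' G's gG' gA.
case: Gc G'c => [[B [fB GB ->]]|[uG ->]] G'c.
  have B0 := proper_neq0 GB.
  have G'B : G' \subset B.
    case: G'c => [[C [fC G'C BC]]|[uG' BE]].
      by rewrite (cell_inj fB fC B0 (proper_neq0 G'C) BC) proper_sub.
    by case: (cell_pt_neq fB B0).
  have [H [GH HB Hneg]] := visible_ridge fG fB GB Gq (fintype.subsetP G'B _ gG') gq.
  have [fH GsH _] := GH.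
  by exists H; split=> //; apply/cell_sub => //; apply: proper_neq0 GsH.
have [B [C [fB fC GB BC]]] := dm_gt1 fG G2.
have [B' [fB' uB' GB' [h hB' hq]]] :=
  negative_unbounded_subface fG fB fC GB BC uG Gq (yq uG) gq.
have [H [GH HB Hneg]] := visible_ridge fG fB' GB' Gq hB' hq.
have [fH GsH _] := GH.
exists H; split=> //; apply/pt_sub => //; first exact: proper_neq0 GsH.
exact: unbounded_face_sub uB'.
Qed.

Lemma meet_nonempty : s1 != [::] -> exists H, [/\ ridge G H, M (cell H) &
    forall h, h \in H -> h \notin G -> a h q < 0].
Proof.
case s1E : s1 => [//|c s'] _.
have [|G' AG' cE] := s1_ridge (c := c); first by rewrite s1E mem_head.
have [_ /properP[AsG' [g gG' gA]] _] := AG'.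
have gq : a g q < 0 by apply: s1_neg gG' gA => //; rewrite -cE s1E mem_head.
have [B [fB GB [h hB hq]]] := negative_subface fG (dm_gt0 fG G1) Gq yq gq.
have [H [GH HB Hneg]] := visible_ridge fG fB GB Gq hB hq.
exists H; split=> //; have [_ /properP[_ [k kH kG]] _] := GH.
exact: meet_visible (Hneg k kH kG).
Qed.

Lemma meet_sub c : M c -> cplx G c.
Proof. by move=> /meet_earlierP[]. Qed.

Lemma maximal_meet c : (1 < dm G)%N -> maximal_cells M c <->
  exists H, [/\ ridge G H, c = cell H & forall h, h \in H -> h \notin G -> a h q < 0].
Proof.
move=> G2; split=> [[Mc cmax]|[H [GH -> Hneg]]].
  have [H [GH cH Hneg]] := meet_in_visible Mc G2.
  exists H; split=> //; apply/esym/cmax => //.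
  have [_ /properP[_ [k kH kG]] _] := GH.
  exact: meet_visible (Hneg k kH kG).
have [_ /properP[_ [k kH kG]] _] := GH.
split; first exact: meet_visible (Hneg k kH kG).
have [_ Hmax] : maximal_cells (cplx G) (cell H) by apply/maximal_cplx => //; exists H.
by move=> c' /meet_sub; apply: Hmax.
Qed.

Lemma meet_pure : s1 != [::] -> pure_of_dim dim M (dm G).-1.
Proof.
move=> /meet_nonempty[H [GH MH _]]; split; first by exists (cell H).
move=> c; have [G2|] := ltnP 1%N (dm G).
  move=> /(maximal_meet _ G2)[K [GK -> _]]; have [fK GsK _] := GK.
  by rewrite dim_cell ?(dm_ridge fG GK) //; apply: proper_neq0 GsK.
(* Here [dm G = 1] and the shared cells are points, possibly only the one at infinity. *)
move=> Gle [/meet_sub /(dim_cplx fG) cG _].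
by apply/eqP; rewrite eqn_leq -ltnS prednK // cG /=; case: (dm G) G1 Gle => [|[]].
Qed.

End Step.

(** Ratios belong to active sets, the list to cells; quantifying over the ridges avoids an inverse
    of [cell]. *)
Definition ordered A p x (s : seq (set T)) := pairwise (fun c c' =>
  `[< forall G G', ridge A G -> ridge A G' -> c = cell G -> c' = cell G' ->
      ratio A p x G < ratio A p x G' >]) s.

Lemma shelling_cplx1 A s : face A -> dm A = 1%N ->
  enumerates (maximal_cells (cplx A)) s -> shelling dim (cplx A) s.
Proof.
move=> fA A1 sA; apply: Shelling0 => //; split=> [|c Ac]; last first.
  by rewrite -ltnS -A1 dim_cplx.
have [|B fB AB] := dm_gt0 fA; first by rewrite A1.
exists (cell B); first exact: cplx_cell.
rewrite dim_cell //; last exact: proper_neq0 AB.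
by apply/eqP; rewrite -leqn0 -ltnS -A1 dm_proper.
Qed.

(* A line shelling: the ridges of A are ordered by the value of p at the
   functional defining them, normalised by its value at the point x of the
   relative interior. *)
Lemma shelling_cplx m A p x s : face A -> dm A = m.+1 ->
  enumerates (maximal_cells (cplx A)) s ->
  in_cone x -> active x = A -> in_span A p ->
  (unbounded_face A -> y p = 0 /\ y x = 0) ->
  (0 < m)%N -> ordered A p x s -> shelling dim (cplx A) s.
Proof.
elim: m A p x s => // m IH A p x s fA dmA sA xK xA Ap yA _ sord.
have A2 : (1 < dm A)%N by rewrite dmA.
have [s_uniq s_mem] := sA.
have sP c : c \in s <-> exists2 G, ridge A G & c = cell G.
  by split=> [/s_mem /(maximal_cplx _ fA A2)//|/(maximal_cplx _ fA A2) /s_mem].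
(* The last clause comes from the strictness of the order of ratios; it allows a generic point to be
   chosen inside [G]. *)
have step s1 c s2 : s = s1 ++ c :: s2 -> exists G q, [/\ ridge A G, c = cell G,
    in_span G q, unbounded_face G -> y q = 0 &
    [/\ forall c, c \in s1 -> exists2 G', ridge A G' & c = cell G',
      forall G' g, ridge A G' -> cell G' \in s1 -> g \in G' -> g \notin A -> a g q < 0,
      forall G' g, ridge A G' -> g \in G' -> g \notin A -> a g q < 0 -> cell G' \in s1 &
      forall G' g, ridge A G' -> g \in G' -> g \notin G -> a g q != 0]].
  move=> sE; have [G AG cE] : exists2 G, ridge A G & c = cell G.
    by apply/sP; rewrite sE mem_cat mem_head orbT.
  have xpos g : g \notin A -> 0 < a g x by rewrite -xA; apply: a_gt0.
  pose q := p - ratio A p x G *: x.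
  have aq G' g : ridge A G' -> g \in G' ->
      a g q = (ratio A p x G' - ratio A p x G) * a g x.
    by move=> AG' gG'; rewrite !linE (ratioP AG' xK xA Ap gG'); ring.
  have s1lt G' : ridge A G' -> cell G' \in s1 -> ratio A p x G' < ratio A p x G.
    move=> AG' G's; move: sord; rewrite /ordered sE pairwise_cat => /and3P[/allrelP H _ _].
    by have /asboolP := H _ c G's (mem_head _ _); apply.
  have s2lt G' : ridge A G' -> cell G' \in s2 -> ratio A p x G < ratio A p x G'.
    move=> AG' G's; move: sord; rewrite /ordered sE pairwise_cat /=.
    move=> /and4P[_ _ /allP H _].
    by have /asboolP := H _ G's; apply.
  have tri G' : ridge A G' -> [\/ cell G' \in s1, G' = G | cell G' \in s2].
    move=> AG'; have : cell G' \in s by apply/sP; exists G'.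
    rewrite sE mem_cat inE => /or3P[]; [by constructor 1| |by constructor 3].
    rewrite cE => /eqP /(ridge_cell_inj AG' AG); by constructor 2.
  exists G, q; split=> //.
  - by move=> g gG; rewrite (aq G) // subrr mul0r.
  - have AsG : A \proper G by case: AG.
    by move=> /(unbounded_face_sub (proper_sub AsG)) /yA[yp yx]; rewrite !linE yp yx; lra.
  split.
  - by move=> b bs; apply/sP; rewrite sE mem_cat bs.
  - by move=> G' g AG' G's gG' gA; rewrite (aq G') // pmulr_llt0 ?xpos // subr_lt0 s1lt.
  - move=> G' g AG' gG' gA; rewrite (aq G') // pmulr_llt0 ?xpos // subr_lt0.
    case: (tri G' AG') => // [->|/s2lt H]; first by rewrite ltxx.
    by move=> /(lt_trans (H AG')); rewrite ltxx.
  - move=> G' g AG' gG' gG.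
    have gA : g \notin A.
      by have [_ AsG _] := AG; apply: contra gG; apply/fintype.subsetP/proper_sub.
    rewrite (aq G') // mulf_eq0 subr_eq0 negb_or (gt_eqF (xpos _ gA)) andbT.
    case: (tri G' AG') => [/s1lt H|E|/s2lt H].
    - by rewrite lt_eqF // H.
    - by rewrite -E gG' in gG.
    - by rewrite gt_eqF // H.
have next s1 c s2 : s = s1 ++ c :: s2 -> exists t1 t2,
    shelling dim (boundary (cplx A) c) (t1 ++ t2) /\
    (s1 != [::] -> enumerates (maximal_cells (meet_earlier (cplx A) s1 c)) t1).
  move=> /step[G [q [AG -> Gq yq [s1P s1neg negs1 qn0]]]].
  have [fG AsG _] := AG; rewrite boundary_cplx //.
  have dmG : dm G = m.+1 by apply/eqP; rewrite -eqSS -dmA (dm_ridge fA AG).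
  have G1 : (0 < dm G)%N by rewrite dmG.
  (* If [G] has dimension 1, its boundary consists of points, and it suffices to list the shared
     ones first. *)
  have [m0|m1] := posnP m.
    rewrite m0 in dmG; have [t t_uniq tP] := cplx_enum G.
    pose M := meet_earlier (cplx A) s1 (cell G).
    have MG c' : M c' -> cplx G c' by apply: meet_sub.
    exists [seq c' <- t | `[< M c' >]], [seq c' <- t | ~~ `[< M c' >]]; split.
      apply: shelling_cplx1 => //; rewrite (maximal_cplx1 fG dmG) //; split.
        by rewrite (perm_uniq (permEl (perm_filterC _ _))).
      by move=> c'; rewrite (perm_mem (permEl (perm_filterC _ _))).
    move=> _; rewrite (maximal_cplx1 fG dmG) //; split; first exact: filter_uniq.
    move=> c'; rewrite mem_filter; split=> [/andP[/asboolP]//|Mc'].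
    by apply/andP; split; [exact/asboolP | apply/tP/MG].
  have G2 : (1 < dm G)%N by rewrite dmG.
  (* A new normalising point in the relative interior of [G], such that no two ridges of [G] tie; by
     the diamond property, [q] vanishes on none of their functionals outside [G]. *)
  have [|x' [x'K x'G yx' x'inj]] := generic_ratio fG Gq.
    move=> H h GH hH hG; have [w [wK yw wG]] := fG.
    have [G' [AG' G'H [g gG' gG]]] := diamond fA AG GH.
    have [l lP] := ridge_ratio GH wK wG Gq.
    have wpos k : k \notin G -> 0 < a k w by rewrite -wG; apply: a_gt0.
    have gH := fintype.subsetP G'H _ gG'.
    move: (qn0 G' g AG' gG' gG); rewrite !lP // !mulf_eq0 !negb_or => /andP[-> _] /=.
    by rewrite gt_eqF // wpos.
  pose l := ratio G q x'.
  pose ridges := [seq H <- enum {set I} | `[< ridge G H >]].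
  pose sorted_by (P : pred {set I}) := sort (fun H H' => l H <= l H') [seq H <- ridges | P H].
  have mem_by P H : H \in sorted_by P <-> ridge G H /\ P H.
    rewrite mem_sort mem_filter /ridges mem_filter mem_enum andbT.
    split=> [/andP[PH /asboolP]//|[GH PH]].
    by rewrite PH; apply/asboolP.
  have uniq_by P : uniq (sorted_by P).
    by rewrite sort_uniq filter_uniq // filter_uniq // enum_uniq.
  have sort_by P : pairwise (fun H H' => l H < l H') (sorted_by P).
    rewrite -(pairwise_map l) -lt_sorted_pairwise lt_sorted_uniq_le; apply/andP; split.
      rewrite map_inj_in_uniq // => H H' /mem_by[GH _] /mem_by[GH' _] lE.
      by apply/eqP/negPn/negP => HH'; have := x'inj _ _ GH GH' HH'; rewrite -/l lE eqxx.
    by rewrite sorted_map; apply: sort_sorted => H H'; apply: le_total.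
  (* A negative ratio means visible from [q], so sorting by ratio puts the shared ridges first. *)
  pose neg H := l H < 0.
  have negP H : ridge G H -> neg H <-> forall h, h \in H -> h \notin G -> a h q < 0.
    move=> GH; split=> [Hn h hH hG|Hn].
      by rewrite (ratioP GH x'K x'G) // pmulr_llt0 // a_gt0 // x'G.
    have [_ /properP[_ [k kH kG]] _] := GH.
    by have := Hn k kH kG; rewrite (ratioP GH x'K x'G) // pmulr_llt0 // a_gt0 // x'G.
  have cell_uniq P : uniq (map cell (sorted_by P)).
    rewrite map_inj_in_uniq // => H H' /mem_by[GH _] /mem_by[GH' _].
    exact: ridge_cell_inj GH GH'.
  exists (map cell (sorted_by neg)), (map cell (sorted_by (predC neg))); split.
    apply: (IH G q x') => //; last 1 first.
    - rewrite /ordered -map_cat pairwise_map.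
      have : pairwise (fun H H' => l H < l H') (sorted_by neg ++ sorted_by (predC neg)).
        rewrite pairwise_cat !sort_by !andbT; apply/allrelP => H H' /mem_by[_ Hn] /mem_by[_].
        by rewrite /= /neg -leNgt; apply: lt_le_trans.
      apply: (@sub_in_pairwise _ (fun H => `[< ridge G H >])); last first.
        by apply/allP => H; rewrite mem_cat => /orP[] /mem_by[GH _]; apply/asboolP.
      move=> H H' /asboolP GH /asboolP GH' /= ll; apply/asboolP => K K' GK GK'.
      by move=> /(ridge_cell_inj GH GK) <- /(ridge_cell_inj GH' GK') <-.
    - split.
        rewrite cat_uniq !cell_uniq andbT /=; apply/hasPn => _ /mapP[H /mem_by[GH nH] ->].
        apply/mapP => -[K /mem_by[GK nK] /(ridge_cell_inj GH GK) E].
        by rewrite /= E nK in nH.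
      move=> c'; split=> [|/(maximal_cplx _ fG G2)[H GH ->]].
        rewrite -map_cat => /mapP[H]; rewrite mem_cat => H_in ->.
        by apply/maximal_cplx => //; exists H => //; case/orP: H_in => /mem_by[].
      rewrite -map_cat; apply/map_f; rewrite mem_cat.
      by case: (boolP (neg H)) => nH; apply/orP; [left|right]; apply/mem_by.
    - by move=> uG; split; [apply: yq | apply: yx'].
  move=> _; split=> [|c']; first exact: cell_uniq.
  split=> [/mapP[H /mem_by[GH /(negP H GH) nH] ->]|].
    by apply/(maximal_meet fA AG Gq yq s1P s1neg negs1) => //; exists H.
  move=> /(maximal_meet fA AG Gq yq s1P s1neg negs1 _ G2)[H [GH -> nH]].
  by apply/map_f/mem_by; split=> //; apply/negP.
have [B fB AB] := dm_gt0 fA (ltnW A2).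
have [G AG _] := ridge_exists fB AB; have [fG AsG _] := AG.
apply: (@ShellingS _ _ _ _ m) => //.
- split=> [|c /(dim_cplx fA)]; last by rewrite dmA ltnS.
  exists (cell G); first exact: cplx_cell.
  rewrite dim_cell //; last exact: proper_neq0 AsG.
  by apply/eqP; rewrite -eqSS -dmA (dm_ridge fA AG).
- by move=> c s2 sE; have [t1 [t2 [sh _]]] := next [::] c s2 sE; exists (t1 ++ t2).
- move=> s1 c s2 /step[K [q [AK -> Kq yq [s1P s1neg negs1 _]]]] s1n.
  have [fK AsK _] := AK.
  have dmK : dm K = m.+1 by apply/eqP; rewrite -eqSS -dmA (dm_ridge fA AK).
  exists m; first by rewrite dim_cell // ?dmK //; apply: proper_neq0 AsK.
  have -> : m = (dm K).-1 by rewrite dmK.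
  by apply: (meet_pure fA AK _ Kq yq s1P s1neg negs1 s1n); rewrite dmK.
- by move=> s1 c s2 /next[t1 [t2 [sh en]]] s1n; exists t1, t2; split; last exact: en.
Qed.

End Cone.

(** * Dimension of covector cells *)

Section CellDimension.
Variables (R : realType) (d n : nat) (V : 'M[R]_(d, n)).
Hypothesis d_gt0 : (0 < d)%N.
Implicit Types (x : 'rV[R]_d) (H : {ffun 'I_d -> {set 'I_n}}).

Lemma in_covector x i j :
  reflect (forall k, x 0 i - V i j <= x 0 k - V k j) (j \in point_covector V x i).
Proof. by rewrite ffunE inE; apply: forallP. Qed.

Definition meets H (i k : 'I_d) := ~~ [disjoint H i & H k].

(* The row space of [dir H] is the linear space parallel to the affine hull of
   the cell of H, together with the all-ones vector. *)
Definition dir H : 'M[R]_d :=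
  kermx (\matrix_(l < d, q < #|{: 'I_d * 'I_d}|)
    let: (i, k) := enum_val q in
    if meets H i k then (l == i)%:R - (l == k)%:R else 0).

Lemma dirP H x : reflect (forall i k j, j \in H i -> j \in H k -> x 0 i = x 0 k)
  (x <= dir H)%MS.
Proof.
have entry q : (x *m \matrix_(l < d, q < #|{: 'I_d * 'I_d}|)
    let: (i, k) := enum_val q in
    if meets H i k then (l == i)%:R - (l == k)%:R else 0) 0 q =
    let: (i, k) := enum_val q in if meets H i k then x 0 i - x 0 k else 0.
  rewrite mxE; case qE : (enum_val q) => [i k].
  under eq_bigr => l _ do rewrite mxE qE.
  case: ifP => _; last by rewrite big1 // => l _; rewrite mulr0.
  under eq_bigr => l _ do rewrite mulrBr.
  rewrite sumrB (bigD1 i) //= [X in _ - X](bigD1 k) //= !eqxx !mulr1.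
  by rewrite !big1 ?addr0 // => l /negPf ->; rewrite mulr0.
apply: (iffP sub_kermxP) => [x0 i k j ji jk|x0].
  have := entry (enum_rank (i, k)); rewrite x0 mxE enum_rankK /meets.
  have -> : ~~ [disjoint H i & H k].
    by rewrite -setI_eq0; apply/set0Pn; exists j; rewrite inE ji.
  by move=> /esym /eqP; rewrite subr_eq0 => /eqP.
apply/rowP => q; rewrite entry mxE; case: (enum_val q) => [i k].
case: ifP => //; rewrite /meets -setI_eq0 => /set0Pn[j]; rewrite inE => /andP[ji jk].
by rewrite (x0 i k j) // subrr.
Qed.

Lemma dir_const H (c : R) : ((const_mx c : 'rV_d) <= dir H)%MS.
Proof. by apply/dirP => i k j _ _; rewrite !mxE. Qed.

Lemma repr_pi x : exists c, repr (\pi_(torus R d) x) = x + const_mx c.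
Proof.
have /eqmodP/asboolP[c E] :
  x = repr (\pi_(torus R d) x) %[mod {eq_quot torus_equiv R d}] by rewrite reprK.
by exists c.
Qed.

Lemma cell_diff_dir x (p q : torus R d) :
  covector_cell V (point_covector V x) p -> covector_cell V (point_covector V x) q ->
  (repr p - repr q <= dir (point_covector V x))%MS.
Proof.
move=> xp xq; apply/dirP => i k j ji jk; rewrite !mxE.
have := in_covector _ _ _ (fintype.subsetP (xp i) _ ji) k.
have := in_covector _ _ _ (fintype.subsetP (xp k) _ jk) i.
have := in_covector _ _ _ (fintype.subsetP (xq i) _ ji) k.
have := in_covector _ _ _ (fintype.subsetP (xq k) _ jk) i.
lra.
Qed.

Lemma rank1 : \rank (const_mx 1 : 'rV[R]_d) = 1%N.
Proof.
rewrite rank_rV; case: eqP => // /matrixP /(_ 0 (Ordinal d_gt0)); rewrite !mxE => /eqP.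
by rewrite oner_eq0.
Qed.

Lemma rank_dir_gt0 H : (0 < \rank (dir H))%N.
Proof. by rewrite -rank1 mxrankS // dir_const. Qed.

(** Differences of points of the cell lie in [dir]; conversely [x] can move a little along every
    direction of [dir]. The all-ones vector accounts for the predecessor. *)
Lemma affine_dim_cell x :
  affine_dim (covector_cell V (point_covector V x)) = (\rank (dir (point_covector V x))).-1.
Proof.
set H := point_covector V x; set C := covector_cell V H.
apply/eqP; rewrite eqn_leq; apply/andP; split.
  apply/bigmax_leqP => k /asboolP[p0 [p [Cp0 Cp]]] free.
  rewrite -ltnS prednK ?rank_dir_gt0 //; rewrite -addn1 -(eqP free).
  apply: mxrankS; rewrite col_mx_sub dir_const andbT; apply/row_subP => i.
  by rewrite rowK; exact: (cell_diff_dir (Cp i) Cp0).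
pose D := (dir H :\: (const_mx 1 : 'rV[R]_d))%MS.
have rD : (\rank D).+1 = \rank (dir H).
  rewrite -(mxrank_cap_compl (dir H) (const_mx 1 : 'rV[R]_d)) -/D.
  by rewrite (capmx_idPr (dir_const H 1)) rank1.
have -> : (\rank (dir H)).-1 = \rank D by rewrite -rD.
have Dd : (\rank D < d)%N by rewrite rD rank_leq_col.
have [B BD] : exists B : 'M[R]_(\rank D, d), (B :=: D)%MS.
  by exists (row_base D); apply: eq_row_base.
have Bdir i : (row i B <= dir H)%MS.
  apply: submx_trans (row_sub _ _) _; rewrite BD; exact: diffmxSl.
have [e e0 eP] := small_perturbation
  (fun t : 'I_(\rank D) * 'I_d * 'I_d * 'I_n =>
     let: (i, l, m, j) := t in (x 0 m - V m j) - (x 0 l - V l j))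
  (fun t : 'I_(\rank D) * 'I_d * 'I_d * 'I_n =>
     let: (i, l, m, j) := t in row i B 0 m - row i B 0 l).
pose p i : torus R d := \pi_(torus R d) (x + e *: row i B).
apply: (@leq_bigmax_cond _ _ (fun k : 'I_d => (k : nat)) (Ordinal Dd)).
apply/asboolP; exists (\pi_(torus R d) x), p; split.
- by move=> i; rewrite covector_pi.
- move=> i l; rewrite covector_pi; apply/fintype.subsetP => j jl.
  apply/in_covector => m; rewrite !mxE.
  have lm := in_covector _ _ _ jl m.
  (* Positive gaps survive a small step; at a zero gap [j] lies in both entries, where vectors of
     [dir H] have equal coordinates. *)
  have [xm|xm] := ltP 0 ((x 0 m - V m j) - (x 0 l - V l j)).
    by have := eP (i, l, m, j) xm; rewrite !mxE; lra.
  have jm : j \in H m by apply/in_covector => k; have := in_covector _ _ _ jl k; lra.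
  by have /dirP/(_ l m j jl jm) := Bdir i; rewrite !mxE => ->; lra.
- set P := (X in col_mx X _).
  have sub : (col_mx B (const_mx 1 : 'rV[R]_d) <= col_mx P (const_mx 1 : 'rV[R]_d))%MS.
    have sub1 (c : R) : ((const_mx c : 'rV[R]_d) <= col_mx P (const_mx 1 : 'rV[R]_d))%MS.
      have -> : (const_mx c : 'rV[R]_d) = c *: const_mx 1.
        by apply/matrixP => i j; rewrite !mxE mulr1.
      by rewrite scalemx_sub // -addsmxE addsmxSr.
        rewrite col_mx_sub sub1 andbT; apply/row_subP => i.
    (* Representatives are known up to constants, which the all-ones row absorbs. *)
    have [c cE] := repr_pi (x + e *: row i B); have [c' c'E] := repr_pi x.
    have -> : row i B = e^-1 *: (row i P - const_mx (c - c')).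
      rewrite rowK cE c'E; apply/matrixP => a b; rewrite !mxE.
      have e_unit : e != 0 by rewrite gt_eqF.
      by field.
    apply: scalemx_sub; apply: addmx_sub; last by rewrite eqmx_opp.
    by apply: submx_trans (row_sub _ _) _; rewrite -addsmxE addsmxSl.
  rewrite /row_free eqn_leq rank_leq_row /= -/(\rank D).
  apply: leq_trans (mxrankS sub); rewrite [X in (X <= _)%N]addn1 rD mxrankS //.
  rewrite -addsmxE (adds_eqmx BD (eqmx_refl _)).
  rewrite -{1}(addsmx_diff_cap_eq (dir H) (const_mx 1 : 'rV[R]_d)).
  by apply: addsmxS => //; apply: capmxSr.
Qed.

End CellDimension.

(** * The hypograph of the tropical sum *)

Lemma lex_lt_digits (d n : nat) (t t' : d.-tuplelexi nat) : (t < t')%O ->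
  (forall i, tnth t i <= n)%N ->
  (\sum_(i < d) tnth t i * n.+1 ^ (d - i.+1) < \sum_(i < d) tnth t' i * n.+1 ^ (d - i.+1))%N.
Proof.
move=> /ltxi_tuplePlt[k tE tk] tn.
(* The digits after the first difference, at most [n] each, are worth less than one unit at that
   place. *)
have tail e : (e <= d)%N -> (\sum_(d - e <= i < d) n * n.+1 ^ (d - i.+1) < n.+1 ^ e)%N.
  elim: e => [|e IH] ed; first by rewrite subn0 big_geq.
  have E : (d - e.+1).+1 = (d - e)%N by rewrite subnSK.
  have lt : (d - e.+1 < d)%N by rewrite E leq_subr.
  rewrite (big_ltn lt) E (subKn (ltnW ed)) expnS mulSn [X in (_ < X)%N]addnC.
  by rewrite ltn_add2l IH // ltnW.
rewrite (bigID (fun i : 'I_d => i < k)%N) [X in (_ < X)%N](bigID (fun i : 'I_d => i < k)%N) /=.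
rewrite (eq_bigr (fun i : 'I_d => tnth t' i * n.+1 ^ (d - i.+1))%N) => [|i /tE -> //].
rewrite ltn_add2l (bigD1 k) ?ltnn //= [X in (_ < X)%N](bigD1 k) ?ltnn //=.
apply: leq_trans (leq_addr _ _).
apply: (@leq_trans ((tnth t k).+1 * n.+1 ^ (d - k.+1))); last first.
  by rewrite leq_mul2r [(_ < _)%N]tk orbT.
rewrite mulSn [X in (_ < X)%N]addnC ltn_add2l.
apply: leq_ltn_trans (tail _ (leq_subr _ _)).
rewrite subKn // big_geq_mkord.
rewrite [X in (_ <= X)%N](eq_bigl (fun i : 'I_d => ~~ (i < k)%N && (i != k))) => [|i]; last first.
  by rewrite -leqNgt -(inj_eq val_inj) /= eq_sym andbC -ltn_neqAle.
by apply: leq_sum => i _; rewrite leq_mul2r tn orbT.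
Qed.

Section Hypograph.
Variables (R : realType) (d n : nat) (V : 'M[R]_(d, n)).
Hypotheses (d_gt0 : (0 < d)%N) (n_gt0 : (0 < n)%N).
Local Notation I := (option {ffun 'I_n -> 'I_d}).
Local Notation W := ('rV[R]_d * R^o * R^o)%type.
Implicit Types (x : 'rV[R]_d) (f : {ffun 'I_n -> 'I_d}) (w : W) (g : I).
Implicit Types (A B G : {set I}) (H : {ffun 'I_d -> {set 'I_n}}).

(* A vector (x, z, t) stands for the point x / t at height z / t. The functional
   of f is the gap between z and the affine majorant of F that picks the term f j
   in the j-th minimum; that of [None] is the homogenising coordinate. *)
Definition facet_fun g w : R :=
  if g is Some f then \sum_j (w.1.1 0 (f j) - V (f j) j * w.2) - w.1.2 else w.2.

(* On the graph of F, with t = 1, this is M - (n avg(x) - F(x)), where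
   n avg(x) - F(x) is invariant under translation by the all-ones vector and
   tends to +oo at infinity. *)
Definition trunc (M : R) w : R := M * w.2 + w.1.2 - n%:R / d%:R * \sum_i w.1.1 0 i.

Lemma facet_funP g c (u v : W) :
  facet_fun g (c *: u + v) = c * facet_fun g u + facet_fun g v.
Proof.
case: g => [f|//] /=; rewrite mulrBr mulr_sumr.
rewrite (_ : forall b e q r : R, b - e + (q - r) = (b + q) - (e + r)); last by move=> *; ring.
rewrite -big_split /=; congr (_ - _); apply: eq_bigr => j _.
by rewrite !mxE /GRing.scale /=; ring.
Qed.

Lemma truncP M c (u v : W) : trunc M (c *: u + v) = c * trunc M u + trunc M v.
Proof.
rewrite /trunc /=.
rewrite (_ : \sum_i _ = c * (\sum_i u.1.1 0 i) + \sum_i v.1.1 0 i).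
  by rewrite /GRing.scale /=; ring.
by rewrite mulr_sumr -big_split; apply: eq_bigr => i _; rewrite !mxE.
Qed.

(** The affine majorants that touch F at a point with covector [H]. [None] is left out because the
    homogenising coordinate is positive there. *)
Definition covset H : {set I} :=
  [set g : I | if g is Some f then [forall j, j \in H (f j)] else false]%SET.

Definition tropical_min x f :=
  forall j k, x 0 (f j) - V (f j) j <= x 0 k - V k j.

Lemma tropical_minP x f : reflect (tropical_min x f) (Some f \in covset (point_covector V x)).
Proof.
rewrite inE; apply: (iffP forallP) => [H j k|H j]; first exact: (in_covector _ _ _ _ (H j)).
by apply/in_covector.
Qed.

Lemma tropical_min_exists x : exists f, tropical_min x f.
Proof.
pose i0 := Ordinal d_gt0.
exists [ffun j => [arg min_(i < i0) (x 0 i - V i j)]%O] => j k; rewrite !ffunE.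
by case: Order.TotalTheory.arg_minP => // i _; apply.
Qed.

Definition update f j0 i : {ffun 'I_n -> 'I_d} := [ffun j => if j == j0 then i else f j].

Lemma facet_fun_update f j i w : facet_fun (Some (update f j i)) w =
  facet_fun (Some f) w + (w.1.1 0 i - V i j * w.2) - (w.1.1 0 (f j) - V (f j) j * w.2).
Proof.
rewrite /= (bigD1 j) //= [in RHS](bigD1 j) //= ffunE eqxx.
rewrite (eq_bigr (fun j' => w.1.1 0 (f j') - V (f j') j' * w.2)); first by ring.
by move=> j' /negPf jj'; rewrite ffunE jj'.
Qed.

(** Changing [f] at a single index isolates one term, so an active majorant is minimal term by term,
    even where [w.2 = 0]. *)
Lemma active_min w f : in_cone facet_fun w -> facet_fun (Some f) w = 0 ->
  forall j k, w.1.1 0 (f j) - V (f j) j * w.2 <= w.1.1 0 k - V k j * w.2.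
Proof.
by move=> wK f0 j k; have := wK (Some (update f j k)); rewrite facet_fun_update f0; lra.
Qed.

Lemma scaled_le (t b c u v : R) : 0 < t ->
  (t^-1 * b - u <= t^-1 * c - v) = (b - u * t <= c - v * t).
Proof.
move=> t0; rewrite -(ler_pM2l t0) !mulrBr !mulrA divff ?gt_eqF // !mul1r.
by rewrite [t * u]mulrC [t * v]mulrC.
Qed.

Lemma active_covset w f : in_cone facet_fun w -> 0 < w.2 -> facet_fun (Some f) w = 0 ->
  active facet_fun w = covset (point_covector V ((w.2)^-1 *: w.1.1)).
Proof.
move=> wK y0 f0; have fmin := active_min wK f0.
have minE f' : tropical_min (w.2^-1 *: w.1.1) f' <->
    forall j k, w.1.1 0 (f' j) - V (f' j) j * w.2 <= w.1.1 0 k - V k j * w.2.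
  by split=> H j k; have := H j k; rewrite !mxE; rewrite scaled_le.
apply/setP => -[f'|]; last by rewrite !inE /= gt_eqF.
apply/idP/tropical_minP => [|/minE f'min]; first by rewrite in_active => /eqP /(active_min wK)/minE.
rewrite in_active -f0 /=; apply/eqP; congr (_ - _); apply: eq_bigr => j _.
by apply/le_anti; rewrite fmin f'min.
Qed.

Definition lift x f : W := (x, \sum_j (x 0 (f j) - V (f j) j), 1).

Lemma lift_in_cone x f : tropical_min x f -> in_cone facet_fun (lift x f).
Proof.
move=> fmin [f'|] /=; last exact: ler01.
by rewrite subr_ge0; apply: ler_sum => j _; rewrite mulr1 fmin.
Qed.

Lemma lift_active x f : tropical_min x f ->
  active facet_fun (lift x f) = covset (point_covector V x).
Proof.
move=> fmin; rewrite (active_covset (f := f) (lift_in_cone fmin)) /= ?ltr01 ?invr1 ?scale1r //.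
by apply/eqP; rewrite subr_eq0; apply/eqP/eq_bigr => j _; rewrite mulr1.
Qed.

Lemma sum_le_eq0 (J : finType) (F : J -> R) : (forall j, 0 <= F j) ->
  \sum_j F j <= 0 -> forall j, F j = 0.
Proof.
move=> F0 s0 j; have /eqP : \sum_j F j = 0 by apply/le_anti; rewrite s0 sumr_ge0.
by rewrite psumr_eq0 // => /allP /(_ j (mem_index_enum _)) /eqP.
Qed.

Let dR : 0 < d%:R :> R. Proof. by rewrite ltr0n. Qed.
Let nR : 0 < n%:R :> R. Proof. by rewrite ltr0n. Qed.

Lemma const_min w : exists i, forall k, w.1.1 0 i <= w.1.1 0 k.
Proof.
exists [arg min_(i < Ordinal d_gt0) (w.1.1 0 i)]%O => k.
by case: Order.TotalTheory.arg_minP => // i _; apply.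
Qed.

Lemma facet_fun_const i w : w.2 = 0 ->
  facet_fun (Some [ffun=> i]) w = n%:R * w.1.1 0 i - w.1.2.
Proof.
move=> y0 /=; congr (_ - _).
rewrite (eq_bigr (fun=> w.1.1 0 i)) ?sumr_const ?card_ord ?mulr_natl //.
by move=> j _; rewrite ffunE y0 mulr0 subr0.
Qed.

(** The constant choices give [z <= n min(x)], whereas [0 <= trunc] gives [z >= n avg(x)], so all
    coordinates agree. *)
Lemma trunc_eq0 M w : in_cone facet_fun w -> w.2 = 0 -> 0 <= trunc M w ->
  (forall i k, w.1.1 0 i = w.1.1 0 k) /\ (forall g, facet_fun g w = 0).
Proof.
move=> wK y0; rewrite /trunc y0 mulr0 add0r => yw.
have [i imin] := const_min w.
have := wK (Some [ffun=> i]); rewrite facet_fun_const // => iK.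
have sumE : \sum_k (w.1.1 0 k - w.1.1 0 i) = \sum_k w.1.1 0 k - d%:R * w.1.1 0 i.
  by rewrite sumrB sumr_const card_ord mulr_natl.
have le_avg : n%:R / d%:R * (\sum_k w.1.1 0 k) <= n%:R * w.1.1 0 i by lra.
have {}le_avg : \sum_k w.1.1 0 k <= d%:R * w.1.1 0 i.
  by rewrite -(ler_pM2l (divr_gt0 nR dR)) mulrA divfK ?gt_eqF.
have cst k : w.1.1 0 k = w.1.1 0 i.
  apply/eqP; rewrite -subr_eq0; apply/eqP; move: k.
  by apply: sum_le_eq0 => [k|]; rewrite ?subr_ge0 // sumE subr_le0.
have sE : \sum_k w.1.1 0 k = d%:R * w.1.1 0 i.
  by rewrite (eq_bigr (fun=> w.1.1 0 i)) // sumr_const card_ord mulr_natl.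
split=> [k l|[f|//]]; first by rewrite !cst.
rewrite /= (eq_bigr (fun=> w.1.1 0 i)) => [|j _]; last by rewrite cst y0 mulr0 subr0.
move: yw; rewrite sE mulrA divfK ?gt_eqF // sumr_const card_ord -mulr_natl; lra.
Qed.

Lemma trunc_lineality M w : active facet_fun w = [set: I]%SET ->
  [/\ w.2 = 0, trunc M w = 0 & forall i k, w.1.1 0 i = w.1.1 0 k].
Proof.
move=> wT; have w0 g : facet_fun g w = 0 by apply/eqP; rewrite -in_active wT inE.
have y0 : w.2 = 0 := w0 None; have nx i : n%:R * w.1.1 0 i = w.1.2.
  by have := w0 (Some [ffun=> i]); rewrite facet_fun_const // => /eqP; rewrite subr_eq0 => /eqP.
split=> //.
- rewrite /trunc y0 mulr0 add0r mulrAC mulr_sumr (eq_bigr (fun=> w.1.2)) // sumr_const card_ord.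
  by rewrite -[w.1.2 *+ d]mulr_natr mulfK ?subrr // gt_eqF.
- by move=> i k; apply: (mulfI (negbT (gt_eqF nR))); rewrite !nx.
Qed.

(** * Faces of the truncated hypograph *)

Variable M : R.
(** [M_rep] gives every cell a point with [y > 0], [M_facet] puts [apex M] in the interior of the
    cone, and [M_bounded] keeps bounded cells clear of the cut. *)
Hypothesis M_rep : forall x, exists x' f, [/\ point_covector V x' = point_covector V x,
  tropical_min x' f & 0 < trunc M (lift x' f)].
Hypothesis M_facet : forall f, \sum_j V (f j) j + 1 <= M.
Hypothesis M_bounded : n%:R * (3 * \sum_i \sum_j `|V i j|) < M.

Local Notation face := (face facet_fun (trunc M)).
Local Notation unbounded_face := (unbounded_face facet_fun (trunc M)).

Lemma pos_height w : in_cone facet_fun w -> 0 < trunc M w -> 0 < w.2.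
Proof.
move=> wK yw; have : 0 <= w.2 := wK None; rewrite le_eqVlt => /orP[/eqP w0|//].
have [||_ w0'] := @trunc_eq0 M w wK; [by rewrite -w0|exact: ltW|].
have [|_ yw0 _] := @trunc_lineality M w; last by rewrite yw0 ltxx in yw.
by apply/setP => g; rewrite in_active w0' eqxx inE.
Qed.

Lemma face_covset x : face (covset (point_covector V x)).
Proof.
have [x' [f [<- fmin ypos]]] := M_rep x.
by exists (lift x' f); split=> //; [exact: lift_in_cone | exact: lift_active].
Qed.

Lemma face_nonempty A : face A -> A != finset.set0 ->
  exists x, A = covset (point_covector V x).
Proof.
move=> [w [wK yw <-]] /set0Pn[g]; have w2 := pos_height wK yw.
rewrite in_active; case: g => [f /eqP f0|]; last by rewrite /= gt_eqF.
by exists (w.2^-1 *: w.1.1); apply: active_covset f0.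
Qed.

Lemma covset_neq0 x : covset (point_covector V x) != finset.set0.
Proof.
have [f fmin] := tropical_min_exists x.
by apply/set0Pn; exists (Some f); apply/tropical_minP.
Qed.

(** A point at depth [t] below the origin; [apex M] lies in the cut and is the normalising point for
    the whole cone. *)
Definition apex (t : R) : W := (0, - t, 1).

Lemma facet_fun_apex t f : facet_fun (Some f) (apex t) = t - \sum_j V (f j) j.
Proof.
rewrite /= opprK addrC -sumrN; congr (_ + _); apply: eq_bigr => j _.
by rewrite mxE mulr1 sub0r.
Qed.

Lemma trunc_apex t : trunc M (apex t) = M - t.
Proof. by rewrite /trunc /= mulr1 big1 ?mulr0 ?subr0 // => i _; rewrite mxE. Qed.

Lemma apex_cone t : M - 1 < t ->
  in_cone facet_fun (apex t) /\ active facet_fun (apex t) = finset.set0.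
Proof.
move=> Mt; have pos g : 0 < facet_fun g (apex t).
  case: g => [f|]; last exact: ltr01.
  by rewrite facet_fun_apex; have := M_facet f; lra.
split=> [g|]; first exact: ltW.
by apply/setP => g; rewrite in_active gt_eqF // inE.
Qed.

Lemma face0 : face finset.set0.
Proof.
have [|K0 a0] := @apex_cone (M - 1/2); first by lra.
by exists (apex (M - 1/2)); split=> //; rewrite trunc_apex; lra.
Qed.

Lemma unbounded_face0 : unbounded_face finset.set0.
Proof.
exists (0, -1, 0); split; last exact: finset.sub0set.
  move=> [f|] //=; rewrite opprK addr_ge0 // sumr_ge0 // => j _.
  by rewrite mxE mulr0 subr0.
by rewrite /trunc /= big1 => [|i _]; rewrite ?mxE //; lra.
Qed.

Lemma V_bound i j : `|V i j| <= \sum_i \sum_j `|V i j|.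
Proof.
rewrite (bigD1 i) //= (bigD1 j) //= -addrA lerDl addr_ge0 ?sumr_ge0 // => k _.
by rewrite sumr_ge0.
Qed.

Lemma V_diff i k j : V i j - V k j <= 2 * \sum_i \sum_j `|V i j|.
Proof.
have := V_bound i j; have := V_bound k j.
have := ler_norm (V i j); have := ler_norm (- V k j); rewrite normrN; lra.
Qed.

Lemma covset_update x f j i : tropical_min x f -> j \in point_covector V x i ->
  tropical_min x (update f j i).
Proof.
move=> fmin ji j' k; rewrite ffunE; case: eqP => [->|_]; last exact: fmin.
exact: (in_covector _ _ _ _ ji).
Qed.

(** If every entry is nonempty, coordinates of [w] differ by at most [2 C w.2]; the entries of [V]
    in the height cost another [C] per index, whence [3 C]. *)
Lemma full_support_pos x w : in_cone facet_fun w ->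
  covset (point_covector V x) \subset active facet_fun w ->
  (forall k, point_covector V x k != finset.set0) ->
  (M - n%:R * (3 * \sum_i \sum_j `|V i j|)) * w.2 <= trunc M w.
Proof.
move=> wK xw full; set C := \sum_i _.
have w2 : 0 <= w.2 by apply: (wK None).
have act f : tropical_min x f -> facet_fun (Some f) w = 0.
  by move=> /tropical_minP /(fintype.subsetP xw); rewrite in_active => /eqP.
have [f fmin] := tropical_min_exists x.
have diff k i : w.1.1 0 k - w.1.1 0 i <= 2 * C * w.2.
  have /set0Pn[j jk] := full k.
  have := active_min wK (act _ (covset_update fmin jk)) j i; rewrite ffunE eqxx.
  by have := V_diff k i j; rewrite -/C => H; have := ler_wpM2r w2 H; lra.
have zE := act f fmin; rewrite /= in zE.
have z_ge i : n%:R * w.1.1 0 i - n%:R * (3 * C) * w.2 <= w.1.2.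
  have -> : w.1.2 = \sum_j (w.1.1 0 (f j) - V (f j) j * w.2) by lra.
  rewrite (_ : n%:R * w.1.1 0 i - _ = \sum_(j < n) (w.1.1 0 i - 3 * C * w.2)); last first.
    by rewrite sumr_const card_ord -[RHS]mulr_natl; ring.
  apply: ler_sum => j _; have := diff i (f j).
  have VC : V (f j) j <= C by apply: le_trans (ler_norm _) (V_bound _ _).
  by have := ler_wpM2r w2 VC; lra.
have sum_ge : n%:R * (\sum_i w.1.1 0 i) <= d%:R * (w.1.2 + n%:R * (3 * C) * w.2).
  rewrite mulr_sumr (_ : d%:R * _ = \sum_(i < d) (w.1.2 + n%:R * (3 * C) * w.2)).
    by apply: ler_sum => i _; have := z_ge i; lra.
  by rewrite sumr_const card_ord mulr_natl.
have : n%:R / d%:R * (\sum_i w.1.1 0 i) <= w.1.2 + n%:R * (3 * C) * w.2.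
  by rewrite mulrAC ler_pdivrMr // [X in _ <= X]mulrC.
by rewrite /trunc; lra.
Qed.

Lemma unbounded_faceP x : unbounded_face (covset (point_covector V x)) <->
  exists k, point_covector V x k = finset.set0.
Proof.
split=> [[r [rK yr xr]]|[k k0]].
  apply: contrapT => no; have full k : point_covector V x k != finset.set0.
    by apply/eqP => k0; apply: no; exists k.
  have := full_support_pos rK xr full; have r2 : 0 <= r.2 by apply: (rK None).
  have : 0 <= (M - n%:R * (3 * \sum_i \sum_j `|V i j|)) * r.2 by rewrite mulr_ge0 // subr_ge0 ltW.
  by lra.
(* Along the ray [e_k] the functional of [f] counts the [j] with [f j = k]; none occurs in [covset]
   when the [k]-th entry is empty. *)
have fE f : facet_fun (Some f) (delta_mx 0 k, 0, 0) = \sum_j (f j == k)%:R.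
  by rewrite /= subr0; apply: eq_bigr => j _; rewrite mxE mulr0 subr0.
exists (delta_mx 0 k, 0, 0); split.
- by move=> [f|//]; rewrite fE sumr_ge0.
- rewrite /trunc /= mulr0 addr0 (bigD1 k) //= big1 => [|i /negPf ik]; last by rewrite mxE eqxx ik.
  by rewrite mxE !eqxx addr0 mulr1 sub0r oppr_lt0 divr_gt0.
- apply/fintype.subsetP => -[f|]; last by rewrite inE.
  rewrite !inE => /forallP H; rewrite fE big1 // => j _; have := H j.
  by case: eqP => // ->; rewrite k0 inE.
Qed.

Lemma hypograph_truncation w : in_cone facet_fun w -> trunc M w = 0 ->
  active facet_fun w != [set: I]%SET ->
  face (active facet_fun w) /\ unbounded_face (active facet_fun w).
Proof.
move=> wK yw wT; have w2 : 0 < w.2.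
  have : 0 <= w.2 := wK None; rewrite le_eqVlt => /orP[/eqP w0|//].
  have [||_ w0'] := @trunc_eq0 M w wK; [by rewrite -w0|by rewrite yw|].
  by case/eqP: wT; apply/setP => g; rewrite in_active w0' eqxx inE.
have [->|/set0Pn[[f|]]] := eqVneq (active facet_fun w) finset.set0.
- by split; [exact: face0 | exact: unbounded_face0].
- rewrite in_active => /eqP f0; have aE := active_covset wK w2 f0.
  rewrite aE; split; first exact: face_covset.
  apply/unbounded_faceP; apply: contrapT => no.
  have := @full_support_pos (w.2^-1 *: w.1.1) w wK; rewrite aE yw => /(_ (fintype.subxx _)).
  have : 0 < (M - n%:R * (3 * \sum_i \sum_j `|V i j|)) * w.2 by rewrite mulr_gt0 // subr_gt0.
  move=> H1 H2; have /(lt_le_trans H1) : (M - n%:R * (3 * \sum_i \sum_j `|V i j|)) * w.2 <= 0.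
    by apply: H2 => k; apply/eqP => k0; apply: no; exists k.
  by rewrite ltxx.
- by rewrite in_active /= gt_eqF.
Qed.

(** * Spans and dimensions of the faces *)

Definition cov_of A : {ffun 'I_d -> {set 'I_n}} :=
  [ffun i => [set j | [exists f : {ffun 'I_n -> 'I_d}, (Some f \in A) && (f j == i)]]%SET].

Lemma cov_ofK x : cov_of (covset (point_covector V x)) = point_covector V x.
Proof.
apply/ffunP => i; apply/setP => j; rewrite ffunE inE.
apply/existsP/idP => [[f /andP[/tropical_minP fmin /eqP <-]]|ji].
  by apply/in_covector => k; apply: fmin.
have [f fmin] := tropical_min_exists x.
exists (update f j i); rewrite ffunE !eqxx andbT.
by apply/tropical_minP; apply: covset_update.
Qed.

Lemma covset_sub x x' : covset (point_covector V x) \subset covset (point_covector V x') <->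
  forall i, point_covector V x i \subset point_covector V x' i.
Proof.
split=> [/fintype.subsetP xx' i|xx'].
  apply/fintype.subsetP => j ji; have [f fmin] := tropical_min_exists x.
  have /tropical_minP/xx'/tropical_minP H := covset_update fmin ji.
  by apply/in_covector => k; have := H j k; rewrite ffunE eqxx.
apply/fintype.subsetP => -[f|]; rewrite !inE // => /forallP H.
by apply/forallP => j; apply: (fintype.subsetP (xx' _)).
Qed.

Lemma span_dir x w : in_span facet_fun (covset (point_covector V x)) w -> w.2 = 0 ->
  (w.1.1 <= dir R (point_covector V x))%MS.
Proof.
move=> xw w0; apply/dirP => i k j ji jk; have [f fmin] := tropical_min_exists x.
have /tropical_minP/xw := covset_update fmin ji.
have /tropical_minP/xw := covset_update fmin jk.
by rewrite !facet_fun_update w0 !mulr0; lra.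
Qed.

Lemma dir_span x (u : 'rV[R]_d) f : (u <= dir R (point_covector V x))%MS ->
  tropical_min x f ->
  in_span facet_fun (covset (point_covector V x)) (u, \sum_j u 0 (f j), 0).
Proof.
move=> /dirP xu fmin [f'|]; last by rewrite inE.
move=> /tropical_minP f'min /=; apply/eqP; rewrite subr_eq0; apply/eqP/eq_bigr => j _.
rewrite mulr0 subr0; apply: (xu _ _ j); apply/in_covector => k; [exact: f'min|exact: fmin].
Qed.

Lemma lift_eq0 x f g : tropical_min x f -> g \in covset (point_covector V x) ->
  facet_fun g (lift x f) = 0.
Proof. by move=> fmin; rewrite -(lift_active fmin) in_active => /eqP. Qed.

Local Notation ridge := (ridge facet_fun (trunc M)).

(** All functionals of the ridge equal 1 at the interior point [w], just below the graph. By
    [ridge_ratio] they then share one value [l] at [(u, 0, 0)], so [(u, l, 0)] is in the span. *)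
Lemma ridge0_dir x (u : 'rV[R]_d) : ridge finset.set0 (covset (point_covector V x)) ->
  (u <= dir R (point_covector V x))%MS.
Proof.
move=> x_ridge; have [f fmin] := tropical_min_exists x.
pose w : W := lift x f + (0, -1, 0).
have aw g : facet_fun g w = facet_fun g (lift x f) + (g != None)%:R.
  rewrite (aD facet_funP) /=; congr (_ + _); case: g => [f'|//] /=.
  by rewrite big1 => [|j _]; rewrite ?mxE ?mulr0 ?subrr // sub0r opprK.
have wpos g : 0 < facet_fun g w.
  rewrite aw; case: g => [f'|] /=; last by rewrite addr0 ltr01.
  by rewrite ltr_pwDr // ?ltr01 //; apply: (lift_in_cone fmin (Some f')).
have wK : in_cone facet_fun w by move=> g; apply: ltW.
have w0 : active facet_fun w = finset.set0.
  by apply/setP => g; rewrite in_active gt_eqF // inE.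
have [|l lP] := ridge_ratio facet_funP (truncP M) (v := (u, 0, 0)) x_ridge wK w0.
  by move=> g; rewrite inE.
apply: (@span_dir x (u, l, 0)) => // g gx.
have := lP g gx; rewrite aw (lift_eq0 fmin gx) add0r.
case: g gx => [f'|]; last by rewrite inE.
by move=> _ /=; lra.
Qed.

(** The larger space is the smaller one plus the line of [x - x'], which leaves the smaller face;
    [ridge_ratio] shows that this line suffices. *)
Lemma ridge_dir_rank x x' : ridge (covset (point_covector V x)) (covset (point_covector V x')) ->
  \rank (dir R (point_covector V x)) = (\rank (dir R (point_covector V x'))).+1.
Proof.
move=> xx'; have [_ x_sub _] := xx'.
have [f fmin] := tropical_min_exists x.
have f_in' : Some f \in covset (point_covector V x').
  by apply: (fintype.subsetP (proper_sub x_sub)); apply/tropical_minP.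
have fmin' := tropical_minP _ _ f_in'.
set D := dir R _; set D' := dir R _.
have D'D : (D' <= D)%MS.
  apply/rV_subP => u /dirP uD'; apply/dirP => i k j ji jk.
  by apply: (uD' i k j); apply: (fintype.subsetP ((covset_sub x x').1 (proper_sub x_sub) _)).
have dD : (x - x' <= D)%MS.
  apply/dirP => i k j ji jk; rewrite !mxE.
  have ji' := fintype.subsetP ((covset_sub x x').1 (proper_sub x_sub) i) _ ji.
  have jk' := fintype.subsetP ((covset_sub x x').1 (proper_sub x_sub) k) _ jk.
  have := in_covector _ _ _ _ ji k; have := in_covector _ _ _ _ jk i.
  have := in_covector _ _ _ _ ji' k; have := in_covector _ _ _ _ jk' i; lra.
have dD' : ~~ (x - x' <= D')%MS.
  apply/negP => uD'; have H := dir_span uD' fmin'.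
  have [_ [g gx' gx]] := properP x_sub.
  have : 0 < facet_fun g (lift x f).
    by apply: a_gt0; [exact: lift_in_cone|rewrite lift_active].
  have := H g gx'; have := lift_eq0 fmin' gx'.
  case: g gx' gx => [f'|]; last by rewrite inE.
  move=> _ _ /= H1 H2; rewrite (_ : \sum_j _ = \sum_j (x' 0 (f' j) - V (f' j) j * 1) +
    \sum_j ((x - x') 0 (f' j) - V (f' j) j * 0)); last first.
    by rewrite -big_split; apply: eq_bigr => j _; rewrite !mxE /=; ring.
  rewrite (_ : \sum_j (x 0 (f j) - V (f j) j) = \sum_j (x' 0 (f j) - V (f j) j) +
    \sum_j (x - x') 0 (f j)); last first.
    by rewrite -big_split; apply: eq_bigr => j _; rewrite !mxE /=; ring.
  by lra.
have DD' : (D <= D' + (x - x'))%MS.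
  apply/rV_subP => u uD.
  have [|l lP] := ridge_ratio facet_funP (truncP M) (v := (u, \sum_j u 0 (f j), 0)) xx'
    (lift_in_cone fmin) (lift_active fmin); first exact: dir_span.
  have uE : u = (u - l *: (x - x')) + l *: (x - x') by rewrite subrK.
  rewrite uE addmx_sub_adds //; last by rewrite scalemx_sub.
  apply: (@span_dir x' ((u, \sum_j u 0 (f j), 0) - l *: (lift x f - lift x' f))); last first.
    by rewrite /= subrr scaler0 subr0.
  move=> g gx'; have aP := facet_funP.
  by rewrite (aD aP) (aN aP) (aZ aP) (aD aP) (aN aP) (lift_eq0 fmin' gx') lP // subr0 subrr.
apply/eqP; rewrite eqn_leq; apply/andP; split.
  apply: leq_trans (mxrankS DD') _; apply: leq_trans (mxrank_adds_leqif _ _).1 _.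
  by rewrite -[X in (_ <= X)%N]addn1 leq_add2l rank_leq_row.
rewrite ltn_neqAle mxrankS // andbT; apply: contra dD' => /eqP rE.
apply: submx_trans dD _.
by have := mxrank_leqif_sup D'D; rewrite rE => -[_ <-].
Qed.

(* The empty active set is that of the interior of the hypograph. *)
Definition face_dim A : nat :=
  if A == finset.set0 then d else (\rank (dir R (cov_of A))).-1.

Lemma face_dim_covset x :
  face_dim (covset (point_covector V x)) = (\rank (dir R (point_covector V x))).-1.
Proof. by rewrite /face_dim (negPf (covset_neq0 x)) cov_ofK. Qed.

Lemma face_dim_ridge A G : face A -> ridge A G -> face_dim A = (face_dim G).+1.
Proof.
move=> fA AG; have [fG AsG _] := AG.
have [x' GE] := face_nonempty fG (proper_neq0 AsG); subst G.
rewrite face_dim_covset prednK ?rank_dir_gt0 //.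
have [A0|A0] := eqVneq A finset.set0.
  rewrite /face_dim A0 eqxx; rewrite A0 in AG.
  apply/eqP; rewrite eqn_leq rank_leq_row andbT.
  apply: (@leq_trans (\rank (1%:M : 'M[R]_d))); first by rewrite mxrank1.
  by apply/mxrankS/row_subP => i; apply: ridge0_dir.
have [x AE] := face_nonempty fA A0; subst A.
by rewrite face_dim_covset (ridge_dir_rank AG).
Qed.

Lemma face_dim_vertex A : face A -> (forall B, face B -> ~~ (A \proper B)) ->
  face_dim A = 0%N.
Proof.
move=> fA Amin; have [A0|A0] := eqVneq A finset.set0.
  have := Amin _ (face_covset 0); rewrite A0 finset.proper0.
  by rewrite covset_neq0.
have [x AE] := face_nonempty fA A0; have [x' [f [x'x fmin ypos]]] := M_rep x.
rewrite AE face_dim_covset -x'x; rewrite -x'x in AE.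
apply/eqP; rewrite -leqn0 -ltnS prednK ?rank_dir_gt0 // -(rank1 R d_gt0) mxrankS //.
apply/rV_subP => u udir.
have aP := facet_funP; have yP := truncP M.
pose w := lift x' f; have wK : in_cone facet_fun w := lift_in_cone fmin.
have wA : active facet_fun w = A by rewrite AE lift_active.
pose v : W := (u, \sum_j u 0 (f j), 0).
(* The correction brings [v] into the cut, where [vertex_span] leaves only the lineality space; the
   last coordinate then shows that the correction is zero. *)
pose v' := v - (trunc M v / trunc M w) *: w.
have yv' : trunc M v' = 0.
  by rewrite (yD yP) (yN yP) (yZ yP) divfK ?subrr // gt_eqF.
have v'A : in_span facet_fun A v'.
  move=> g gA; rewrite (aD aP) (aN aP) (aZ aP) (dir_span udir fmin); last by rewrite -AE.
  by rewrite (lift_eq0 fmin) ?mulr0 ?subrr // -AE.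
have v'0 := vertex_span aP yP fA Amin v'A yv'.
have [|u2 _ ucst] := @trunc_lineality M v'.
  by apply/setP => g; rewrite in_active v'0 eqxx inE.
have c0 : trunc M v / trunc M w = 0.
  by move: u2; rewrite /= sub0r [_ *: _]mulr1 => /eqP; rewrite oppr_eq0 => /eqP.
have -> : u = u 0 (Ordinal d_gt0) *: const_mx 1.
  apply/matrixP => i j; rewrite !mxE mulr1 (ord1 i).
  by have := ucst j (Ordinal d_gt0); rewrite /v' c0 scale0r subr0.
exact: scalemx_sub.
Qed.

(** * Cells of the compactification *)

Lemma pi_cell x : covector_cell V (point_covector V x) (\pi_(torus R d) x).
Proof. by move=> i; rewrite covector_pi. Qed.

Lemma covector_cell_sub x x' :
  (covector_cell V (point_covector V x) `<=` covector_cell V (point_covector V x'))%classic <->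
  covset (point_covector V x') \subset covset (point_covector V x).
Proof.
rewrite covset_sub; split=> [sub i|sub p xp i].
  by have := sub _ (pi_cell x) i; rewrite covector_pi.
by apply: fintype.subset_trans (sub i) (xp i).
Qed.

Lemma compactify_sub (C C' : set (torus R d)) :
  (compactify C `<=` compactify C')%classic <-> (C `<=` C')%classic.
Proof.
split=> [sub p Cp|sub q [[p Cp <-]|[-> unbC]]].
- have /sub : compactify C (Some p) by left; exists p.
  by case=> [[p' C'p' [<-]]|[]].
- by left; exists p => //; apply: sub.
- right; split=> // -[K bndK]; apply: unbC.
  by exists K => p Cp; apply: bndK; apply: sub.
Qed.

(** If the [k]-th entry is empty, coordinate [k] can grow without leaving the cell; an index in the
    [i]-th entry bounds [x_i - x_k] from above. *)
Lemma torus_boundedP x : torus_bounded (covector_cell V (point_covector V x)) <->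
  forall k, point_covector V x k != finset.set0.
Proof.
split=> [[K bndK] k|full].
  apply/eqP => k0; pose j0 := Ordinal n_gt0.
  have [f fmin] := tropical_min_exists x; pose i := f j0.
  have ji : j0 \in point_covector V x i by apply/in_covector => l; apply: fmin.
  have ik : i != k by apply/eqP => ik; rewrite ik k0 inE in ji.
  pose t := `|K - x 0 k + x 0 i| + 1.
  have t0 : 0 <= t by rewrite addr_ge0.
  have /bndK : covector_cell V (point_covector V x) (\pi_(torus R d) (x + t *: delta_mx 0 k)).
    move=> l; rewrite covector_pi; apply/fintype.subsetP => j jl.
    have lk : l != k by apply/eqP => lk; rewrite lk k0 inE in jl.
    apply/in_covector => m; have := in_covector _ _ _ _ jl m.
    rewrite !mxE !eqxx (negPf lk) mulr0 addr0 /=; case: eqP => _; rewrite ?mulr1 ?mulr0; lra.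
  move=> /(_ k i); have [c ->] := repr_pi (x + t *: delta_mx 0 k).
  rewrite !mxE !eqxx (negPf ik) mulr0 addr0 mulr1 /t.
  by have := ler_norm (K - x 0 k + x 0 i); lra.
exists (2 * \sum_i \sum_j `|V i j|) => p xp i k; have /set0Pn[j ji] := full i.
have := in_covector _ _ _ _ (fintype.subsetP (xp i) _ ji) k.
by have := V_diff i k j; lra.
Qed.

Lemma unbounded_cellP x : ~ torus_bounded (covector_cell V (point_covector V x)) <->
  unbounded_face (covset (point_covector V x)).
Proof.
rewrite torus_boundedP unbounded_faceP; split=> [nfull|[k k0] /(_ k)]; last by rewrite k0 eqxx.
apply: contrapT => no; apply: nfull => k; apply/eqP => k0; apply: no.
by exists k.
Qed.

Definition face_cell A := compactify (covector_cell V (cov_of A)).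

Lemma face_cell_covset x :
  face_cell (covset (point_covector V x)) = compactify (covector_cell V (point_covector V x)).
Proof. by rewrite /face_cell cov_ofK. Qed.

Lemma face_cell_sub A B : face A -> face B -> A != finset.set0 -> B != finset.set0 ->
  (face_cell A `<=` face_cell B)%classic <-> B \subset A.
Proof.
move=> fA fB /(face_nonempty fA)[x ->] /(face_nonempty fB)[x' ->].
by rewrite !face_cell_covset compactify_sub covector_cell_sub.
Qed.

Lemma infinity_sub A : face A -> A != finset.set0 ->
  ([set None] `<=` face_cell A)%classic <-> unbounded_face A.
Proof.
move=> fA /(face_nonempty fA)[x ->]; rewrite face_cell_covset -unbounded_cellP.
split=> [/(_ None erefl)[[]//|[]//]|unb _ ->].
by right.
Qed.

Lemma face_cell_infinity A : face A -> A != finset.set0 ->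
  ~ (face_cell A `<=` [set None])%classic.
Proof.
move=> fA /(face_nonempty fA)[x ->]; rewrite face_cell_covset.
move=> sub; have : compactify (covector_cell V (point_covector V x)) (Some (\pi_(torus R d) x)).
  by left; exists (\pi_(torus R d) x) => //; apply: pi_cell.
by move=> /sub.
Qed.

Lemma preimage_compactify (C : set (torus R d)) : (Some @^-1` compactify C)%classic = C.
Proof.
by apply/seteqP; split=> p /=; [case=> [[q Cq [<-]]|[]] | left; exists p].
Qed.

Lemma dim_face_cell A : face A -> A != finset.set0 ->
  compact_cell_dim (face_cell A) = face_dim A.
Proof.
move=> fA /(face_nonempty fA)[x ->].
rewrite face_cell_covset /compact_cell_dim preimage_compactify.
by rewrite affine_dim_cell // face_dim_covset.
Qed.

Lemma dim_infinity : @compact_cell_dim R d [set None]%classic = 0%N.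
Proof.
rewrite /compact_cell_dim /affine_dim big1 // => k /asboolP[p0 [p []]].
by [].
Qed.

(** * Interiors and coarse types of maximal cells *)

Lemma nbhs_rV x (U : set 'rV[R]_d) :
  nbhs x U <-> exists2 e, 0 < e & forall x', (forall i, `|x 0 i - x' 0 i| < e) -> U x'.
Proof.
rewrite nbhs_ballP; split=> [[e e0 eU]|[e e0 eU]]; exists e => // x' xx'; apply: eU.
  by rewrite /ball /=; split=> // i j; rewrite (ord1 i); apply: xx'.
by move=> i; case: xx' => _ /(_ 0 i).
Qed.

Lemma interior_torus x (C : set (torus R d)) : (C°)%classic (\pi_(torus R d) x) ->
  exists2 e, 0 < e & forall x', (forall i, `|x 0 i - x' 0 i| < e) -> C (\pi_(torus R d) x').
Proof.
move=> /(@pi_continuous _ {eq_quot torus_equiv R d} x) xC.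
exact/nbhs_rV.
Qed.

Section MaximalCell.
Variables (x : 'rV[R]_d) (f : {ffun 'I_n -> 'I_d}).
Hypothesis x_ridge : ridge finset.set0 (covset (point_covector V x)).
Hypothesis fmin : tropical_min x f.

(** Here [dir] contains every unit vector, so no [j] lies in two entries. *)
Lemma maximal_covector i : point_covector V x i = [set j | f j == i]%SET.
Proof.
apply/setP => j; rewrite inE; have jf : j \in point_covector V x (f j).
  by apply/in_covector => k; apply: fmin.
apply/idP/eqP => [ji|<-//]; apply/eqP.
have /dirP/(_ i (f j) j ji jf) := ridge0_dir (delta_mx 0 i) x_ridge.
by rewrite !mxE !eqxx /=; case: eqP => // _ /eqP; rewrite oner_eq0.
Qed.

Lemma maximal_interior : ((covector_cell V (point_covector V x))°)%classic (\pi_(torus R d) x).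
Proof.
pose U := [set p : torus R d | covector V p = point_covector V x]%classic.
apply: (@interiorS _ U) => [p Up i|]; first by rewrite Up.
suff : open U by move=> /interior_id ->; apply: covector_pi.
rewrite /open /= /quotient_open openE => x' /= Ux'.
have {}Ux' : point_covector V x' = point_covector V x by rewrite -Ux'; apply/esym/covector_pi.
apply/nbhs_rV.
have [e e0 eP] := small_perturbation
  (fun t : 'I_n * 'I_d => (x' 0 t.2 - V t.2 t.1) - (x' 0 (f t.1) - V (f t.1) t.1)) (fun=> -2).
exists e => // x'' near; apply: etrans (covector_pi _ _) _; apply/ffunP => i; apply/setP => j.
rewrite maximal_covector inE.
have fmin' k : k != f j -> x'' 0 (f j) - V (f j) j < x'' 0 k - V k j.
  move=> kf; have jf : j \in point_covector V x' (f j) by rewrite Ux' maximal_covector inE.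
  have jk : j \notin point_covector V x' k by rewrite Ux' maximal_covector inE eq_sym.
  have gap : 0 < (x' 0 k - V k j) - (x' 0 (f j) - V (f j) j).
    rewrite subr_gt0 ltNge; apply: contra jk => jk; apply/in_covector => l.
    exact: le_trans jk (in_covector _ _ _ _ jf l).
  have := eP (j, k) gap; have := near k; have := near (f j); rewrite /= !ltr_norml; lra.
apply/in_covector/eqP => [ji|<- k].
  apply/eqP/negPn/negP => fi; have := fmin' i; rewrite eq_sym fi => /(_ isT).
  by rewrite ltNge ji.
by have [->//|/fmin' /ltW] := eqVneq k (f j).
Qed.

(** If [j] had a second minimiser [k] at [p], lowering coordinate [k] slightly would remove [j] from
    the entry [f j] and leave the cell. *)
Lemma interior_covector (p : torus R d) :
  ((covector_cell V (point_covector V x))°)%classic p -> covector V p = point_covector V x.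
Proof.
rewrite -[p]reprK covector_pi => /[dup] /interior_subset xp /interior_torus[e e0 eC].
apply/ffunP => k; apply/eqP; rewrite finset.eqEsubset.
have := xp k; rewrite covector_pi => ->; rewrite andbT.
apply/fintype.subsetP => j jk; rewrite maximal_covector inE.
apply/negPn/negP => fk; pose x' := repr p - (e / 2) *: delta_mx 0 k.
have : covector_cell V (point_covector V x) (\pi_(torus R d) x').
  apply: eC => i; rewrite !mxE opprB addrCA subrr addr0 normrM ger0_norm; last by lra.
  by rewrite eqxx /=; case: eqP => _; rewrite ?normr1 ?normr0 ?mulr1 ?mulr0; lra.
move=> /(_ (f j)); rewrite covector_pi => /fintype.subsetP /(_ j).
rewrite maximal_covector inE eqxx => /(_ isT) /in_covector /(_ k).
have := in_covector _ _ _ _ jk (f j).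
rewrite !mxE !eqxx (negPf fk) /= mulr0 mulr1 subr0; lra.
Qed.

Lemma maximal_coarse_type : cell_coarse_type V (covector_cell V (point_covector V x)) =
  [tuple #|[set j | f j == i]%SET| | i < d].
Proof.
rewrite /cell_coarse_type /coarse_type interior_covector.
  by apply/eq_from_tnth => i; rewrite !tnth_mktuple maximal_covector.
by apply: xgetPex; exists (\pi_(torus R d) x); apply: maximal_interior.
Qed.

End MaximalCell.

(** * The lexicographic direction *)

Lemma sum_fibers f (F : 'I_d -> R) :
  \sum_j F (f j) = \sum_i F i * #|[set j | f j == i]%SET|%:R.
Proof.
rewrite (partition_big f xpredT) //=; apply: eq_bigr => i _.
rewrite (eq_bigr (fun=> F i)) => [|j /eqP-> //].
rewrite (eq_bigl (fun j => j \in [set j | f j == i]%SET)) => [|j]; last by rewrite inE.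
by rewrite sumr_const mulr_natr.
Qed.

(* Base n + 1 digits: the linear functional [lex_dir] orders the coarse types,
   whose entries are at most n, lexicographically. *)
Definition lex_dir : W :=
  (\row_i (n.+1 ^ (d - i.+1))%:R, n%:R / d%:R * \sum_(i < d) (n.+1 ^ (d - i.+1))%:R, 0).

Lemma trunc_lex_dir : trunc M lex_dir = 0.
Proof.
rewrite /trunc /= mulr0 add0r; apply/eqP; rewrite subr_eq0; apply/eqP; congr (_ * _).
by apply: eq_bigr => i _; rewrite mxE.
Qed.

(** The values are integers up to a common shift, so a strict inequality gains 1. *)
Lemma facet_lex_dir f f' :
  ([tuple #|[set j | f j == i]%SET| | i < d] <
   [tuple #|[set j | f' j == i]%SET| | i < d] :> d.-tuplelexi nat)%O ->
  facet_fun (Some f) lex_dir + 1 <= facet_fun (Some f') lex_dir.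
Proof.
move=> /(@lex_lt_digits _ n) lt.
have E h : facet_fun (Some h) lex_dir =
    (\sum_(i < d) tnth [tuple #|[set j | h j == i]%SET| | i < d] i * n.+1 ^ (d - i.+1))%:R -
    n%:R / d%:R * \sum_(i < d) (n.+1 ^ (d - i.+1))%:R.
  rewrite /= (eq_bigr (fun j => (n.+1 ^ (d - (h j).+1))%:R)) => [|j _]; last first.
    by rewrite mxE mulr0 subr0.
  rewrite (sum_fibers h (fun i : 'I_d => (n.+1 ^ (d - i.+1))%:R)) natr_sum.
  by congr (_ - _); apply: eq_bigr => i _; rewrite tnth_mktuple natrM mulrC.
rewrite !E addrAC lerD2r natr1 ler_nat; apply: lt => i.
by rewrite tnth_mktuple -[X in (_ <= X)%N]card_ord max_card.
Qed.

Hypothesis M_order : forall f f',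
  2 * `|facet_fun (Some f) lex_dir * \sum_j V (f' j) j| < M.

(** After cross-multiplication the gap of 1 is scaled by [M], which exceeds the two products bounded
    by [M_order]. *)
Lemma lex_dir_ratio f f' :
  facet_fun (Some f) lex_dir + 1 <= facet_fun (Some f') lex_dir ->
  facet_fun (Some f) lex_dir / facet_fun (Some f) (apex M) <
  facet_fun (Some f') lex_dir / facet_fun (Some f') (apex M).
Proof.
rewrite !facet_fun_apex => lt.
have := M_order f f'; have := M_order f' f; have := M_facet f; have := M_facet f'.
set b := \sum_j V (f j) j; set b' := \sum_j V (f' j) j.
move: lt; set c := facet_fun _ lex_dir; set c' := facet_fun _ lex_dir.
move=> lt Mf' Mf o1 o2.
rewrite ltr_pdivrMr; last by lra.
rewrite mulrAC ltr_pdivlMr; last by lra.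
have := ler_norm (c' * b); have := ler_norm (- (c * b')); rewrite normrN.
have := normr_ge0 (c * b'); nra.
Qed.

(** Equal types mean parallel majorants. Each bounds F at the point where the other touches it, so
    they coincide. *)
Lemma coarse_type_inj x x' f f' :
  ridge finset.set0 (covset (point_covector V x)) ->
  ridge finset.set0 (covset (point_covector V x')) ->
  tropical_min x f -> tropical_min x' f' ->
  [tuple #|[set j | f j == i]%SET| | i < d] = [tuple #|[set j | f' j == i]%SET| | i < d] ->
  point_covector V x = point_covector V x'.
Proof.
move=> xr xr' fmin fmin' tE.
have sE (F : 'I_d -> R) : \sum_j F (f j) = \sum_j F (f' j).
  rewrite !sum_fibers; apply: eq_bigr => i _; congr (_ * _%:R).
  by have := congr1 (fun t => tnth t i) tE; rewrite !tnth_mktuple.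
have lift_ge := lift_in_cone fmin (Some f').
have lift_ge' := lift_in_cone fmin' (Some f).
have f'x : tropical_min x f'.
  apply/tropical_minP; rewrite -(lift_active fmin) in_active eq_le lift_ge andbT.
  move: lift_ge'; rewrite /= !sumrB (sE (x 0)) (sE (x' 0)).
  have VE (h : {ffun 'I_n -> 'I_d}) : \sum_j V (h j) j * 1 = \sum_j V (h j) j.
    by apply: eq_bigr => j _; rewrite mulr1.
  by rewrite !VE; lra.
by apply/ffunP => i; rewrite (maximal_covector xr f'x) (maximal_covector xr' fmin').
Qed.

(** * The decomposition as boundary complex of the hypograph *)

Lemma decompositionP (C : set (torus R d)) : covector_decomposition V C <->
  exists x, C = covector_cell V (point_covector V x).
Proof.
split=> [[_ [p _ <-] ->]|[x ->]]; first by exists (repr p).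
by exists (point_covector V x) => //; exists (\pi_(torus R d) x) => //; apply: covector_pi.
Qed.

Lemma compactify_inj : injective (@compactify R d).
Proof. by move=> C C' E; rewrite -[C]preimage_compactify E preimage_compactify. Qed.

Lemma compactify_infinity (C : set (torus R d)) : covector_decomposition V C ->
  ~ (compactify C `<=` [set None])%classic.
Proof.
move=> /decompositionP[x ->] sub.
have : compactify (covector_cell V (point_covector V x)) (Some (\pi_(torus R d) x)).
  by left; exists (\pi_(torus R d) x) => //; apply: pi_cell.
by move=> /sub.
Qed.

Lemma enumerates_compactify s :
  enumerates (maximal_cells (covector_decomposition V)) s ->
  enumerates (maximal_cells (compactified_decomposition V)) [seq compactify C | C <- s].
Proof.
move=> [s_uniq s_mem]; split=> [|c]; first by rewrite map_inj_uniq //; apply: compactify_inj.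
split=> [/mapP[C /s_mem[CV Cmax] ->]|[[[C CV <-]|[-> [C CV Cunb]]] cmax]].
- split=> [|c']; first by left; exists C.
  move=> [[C' C'V <-]|[-> _]]; last by move=> /(compactify_infinity CV).
  by move=> /compactify_sub /(Cmax _ C'V) ->.
- apply/map_f/s_mem; split=> // C' C'V CC'; apply: compactify_inj; apply: cmax.
    by left; exists C'.
  exact/compactify_sub.
- have CE : compactify C = [set None]%classic.
    apply: cmax; first by left; exists C.
    by move=> _ ->; right.
  by case: (compactify_infinity CV); rewrite CE.
Qed.

Lemma compactified_cplx : (1 < d)%N ->
  compactified_decomposition V = cplx facet_fun (trunc M) face_cell [set None]%classic finset.set0.
Proof.
move=> d1; apply/seteqP; split=> c.
  move=> [[C /decompositionP[x ->] <-]|[-> _]]; last by right; split=> //; apply: unbounded_face0.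
  left; exists (covset (point_covector V x)); split; first exact: face_covset.
    by rewrite finset.proper0 covset_neq0.
  by rewrite face_cell_covset.
move=> [[B [fB /proper_neq0 /(face_nonempty fB)[x ->] ->]]|[_ ->]].
  left; exists (covector_cell V (point_covector V x)); last by rewrite face_cell_covset.
  by apply/decompositionP; exists x.
right; split=> //.
have aP := facet_funP; have yP := truncP M.
(* The hypograph has dimension [d > 1], so it has an unbounded proper face, hence an unbounded cell
   exists. *)
have [|B [C [fB fC sB BC]]] := dm_gt1 face_dim_ridge face_dim_vertex face0.
  by rewrite /face_dim eqxx.
have [B' [fB' uB' /proper_neq0]] :=
  unbounded_proper_subface aP yP hypograph_truncation face0 fB fC sB BC unbounded_face0.
move=> /(face_nonempty fB')[x B'E]; exists (covector_cell V (point_covector V x)).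
  by apply/decompositionP; exists x.
by apply/unbounded_cellP; rewrite -B'E.
Qed.

Lemma lexicographic_ordered s : lexicographic_ordering V s ->
  ordered facet_fun (trunc M) face_cell finset.set0 lex_dir (apex M)
    [seq compactify C | C <- s].
Proof.
move=> [[s_uniq s_mem]]; rewrite sorted_map sorted_pairwise; last first.
  by move=> C1 C2 C3; apply: le_trans.
rewrite uniq_pairwise in s_uniq => s_le; rewrite /ordered pairwise_map.
have := introT andP (conj s_le s_uniq); rewrite -pairwise_relI.
apply: sub_pairwise => C C' /= /andP[le_t neqC]; apply/asboolP => G G' rG rG' CE C'E.
have [fG GsG _] := rG; have [fG' GsG' _] := rG'.
have [x GE] := face_nonempty fG (proper_neq0 GsG); subst G.
have [x' G'E] := face_nonempty fG' (proper_neq0 GsG'); subst G'.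
rewrite face_cell_covset in CE; move/compactify_inj in CE; subst C.
rewrite face_cell_covset in C'E; move/compactify_inj in C'E; subst C'.
have [f fmin] := tropical_min_exists x; have [f' fmin'] := tropical_min_exists x'.
rewrite (maximal_coarse_type rG fmin) (maximal_coarse_type rG' fmin') in le_t.
have [|apexK apex0] := @apex_cone M; first by lra.
have span0 : in_span facet_fun finset.set0 lex_dir by move=> g; rewrite inE.
have lt_t : ([tuple #|[set j | f j == i]%SET| | i < d] <
   [tuple #|[set j | f' j == i]%SET| | i < d] :> d.-tuplelexi nat)%O.
  rewrite lt_neqAle le_t andbT; apply: contra neqC => /eqP tE.
  by rewrite (coarse_type_inj rG rG' fmin fmin' tE).
have := lex_dir_ratio (facet_lex_dir lt_t).
have pos h : facet_fun (Some h) (apex M) != 0.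
  by apply: lt0r_neq0; apply: a_gt0 => //; rewrite apex0 inE.
have fin : Some f \in covset (point_covector V x) by apply/tropical_minP.
have fin' : Some f' \in covset (point_covector V x') by apply/tropical_minP.
rewrite (ratioP facet_funP (truncP M) rG apexK apex0 span0 fin) mulfK //.
by rewrite (ratioP facet_funP (truncP M) rG' apexK apex0 span0 fin') mulfK.
Qed.

Lemma lexicographic_shelling s : (1 < d)%N -> lexicographic_ordering V s ->
  shelling (@compact_cell_dim R d) (compactified_decomposition V) [seq compactify C | C <- s].
Proof.
move=> d1 s_lex; have := enumerates_compactify s_lex.1; rewrite compactified_cplx // => s_enum.
have [|apexK apex0] := @apex_cone M; first by lra.
have lineality w : active facet_fun w = [set: I]%SET -> trunc M w = 0.
  by move=> /(trunc_lineality M)[].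
apply: (shelling_cplx facet_funP (truncP M) hypograph_truncation lineality
  face_dim_ridge face_dim_vertex face_cell_sub infinity_sub face_cell_infinity
  dim_face_cell dim_infinity (m := d.-1) face0 _ s_enum apexK apex0 _ _ _
  (lexicographic_ordered s_lex)).
- by rewrite /face_dim eqxx prednK.
- by move=> g; rewrite inE.
- by rewrite trunc_lex_dir trunc_apex subrr.
- by rewrite -ltnS prednK.
Qed.

End Hypograph.

(** * Choice of the truncation level *)

Section TruncationLevel.
Variables (R : realType) (d n : nat) (V : 'M[R]_(d, n)) (d_gt0 : (0 < d)%N).

Lemma truncation_level : exists M : R, [/\
  forall x, exists x' f, [/\ point_covector V x' = point_covector V x,
    tropical_min V x' f & 0 < trunc n M (lift V x' f)],
  forall f : {ffun 'I_n -> 'I_d}, \sum_j V (f j) j + 1 <= M,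
  n%:R * (3 * \sum_i \sum_j `|V i j|) < M &
  forall f f' : {ffun 'I_n -> 'I_d},
    2 * `|facet_fun V (Some f) (lex_dir R d n) * \sum_j V (f' j) j| < M].
Proof.
pose rep (H : {ffun 'I_d -> {set 'I_n}}) :=
  xget (0 : 'rV[R]_d) [set x | point_covector V x = H]%classic.
pose argm H := sval (cid (tropical_min_exists V d_gt0 (rep H))).
have argmP H : tropical_min V (rep H) (argm H) := svalP (cid (tropical_min_exists V d_gt0 (rep H))).
pose b (f : {ffun 'I_n -> 'I_d}) := \sum_j V (f j) j.
pose h H := trunc n 0 (lift V (rep H) (argm H)).
pose o (q : {ffun 'I_n -> 'I_d} * {ffun 'I_n -> 'I_d}) :=
  2 * `|facet_fun V (Some q.1) (lex_dir R d n) * b q.2|.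
have le_sum (J : finType) (F : J -> R) j : `|F j| <= \sum_i `|F i|.
  by rewrite (bigD1 j) //= lerDl sumr_ge0.
have sum_ge0 (J : finType) (F : J -> R) : 0 <= \sum_i `|F i| by rewrite sumr_ge0.
pose c := n%:R * (3 * \sum_i \sum_j `|V i j|).
have c0 : 0 <= c by rewrite !mulr_ge0 // sumr_ge0 // => i _; rewrite sumr_ge0.
have h0 := sum_ge0 _ h; have b0 := sum_ge0 _ b; have o0 := sum_ge0 _ o.
exists (1 + \sum_H `|h H| + \sum_f `|b f| + c + \sum_q `|o q|); split.
- move=> x; pose H := point_covector V x; exists (rep H), (argm H); split=> //.
    exact: (@xgetPex _ 0 [set x | point_covector V x = H]%classic (ex_intro _ x erefl)).
  have := le_sum _ h H; have := ler_norm (- h H); rewrite normrN {1}/h /trunc /= !mulr1.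
  by lra.
- by move=> f; have := le_sum _ b f; have := ler_norm (b f); rewrite /b; lra.
- by rewrite -/c; lra.
- move=> f f'; have := le_sum _ o (f, f'); have := ler_norm (o (f, f')); rewrite {1}/o /=.
  by lra.
Qed.

End TruncationLevel.

Theorem theorem5p7 (R : realType) (d n : nat) (d_gt0 : (0 < d)%N)
    (n_gt0 : (0 < n)%N) (V : 'M[R]_(d, n)) (s : seq (set (torus R d)))
    (s_lex : lexicographic_ordering V s) :
  shelling (@compact_cell_dim R d) (compactified_decomposition V)
    [seq compactify C | C <- s].
Proof.
have [d1|d1] := ltnP 1 d.
  have [M [M1 M2 M3 M4]] := truncation_level V d_gt0.
  exact: (lexicographic_shelling d_gt0 n_gt0 M1 M2 M3 M4).
(* For [d = 1] the torus is a single point and every cell has dimension 0. *)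
apply: Shelling0; first exact: (enumerates_compactify s_lex.1).
have dim0 D : @compact_cell_dim R d D = 0%N.
  apply/eqP; rewrite -leqn0; apply/bigmax_leqP => k _.
  by rewrite -ltnS (leq_trans (ltn_ord k)).
split=> [|c _]; last by rewrite dim0.
exists (compactify (covector_cell V (point_covector V 0))) => //.
by left; exists (covector_cell V (point_covector V 0)) => //; apply/decompositionP; exists 0.
Qed.
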